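(* Let $E$ be an AM-space and let $(e^{tA})_{t\geq 0}$ be a positive $C_0$-semigroup on $E$ with generator $A$. Then $s(A)=\omega_0(A)$, i.e. the spectral bound of $A$ equals the growth bound of the semigroup.
   Context: An AM-space is a Banach lattice $E$ such that $\|\sup\{f,g\}\| = \sup\{\|f\|,\|g\|\}$ for all $f,g\in E$ with $f \ge 0$ and $g\ge 0$. (If the Banach lattice is over the complex field, order relations refer to its real part; if it is over the real field, the spectrum of an operator is understood via complexification.) For a $C_0$-semigroup on $E$ with generator $A$, the semigroup is denoted by $(e^{tA})_{t\ge 0}$. It is called positive if $e^{tA}f \ge 0$ for all $t \ge 0$ and all $0 \le f\in E$. The spectral bound is $s(A) := \sup\{\operatorname{Re}\lambda : \lambda \text{ is a spectral value of } A\} \in [-\infty,\infty)$, with $\sup\emptyset=-\infty$. The growth bound is $\omega_0(A) := \inf\{\omega\in\mathbb{R} : (e^{t(A-\omega)})_{t\geq 0} \text{ is bounded}\}\in[-\infty,\infty)$, where $e^{t(A-\omega)} = e^{-\omega t}e^{tA}$ and bounded means $\sup_{t\ge 0}\|e^{t(A-\omega)}\|<\infty$. *)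

(* Defs.v *)
From HB Require Import structures.
From mathcomp Require Import all_boot all_order all_algebra.
From mathcomp Require Import all_classical all_reals all_analysis.
From mathcomp.real_closed Require Export complex.

Set Implicit Arguments.
Unset Strict Implicit.
Unset Printing Implicit Defensive.

Import Order.TTheory GRing.Theory Num.Theory.
Import numFieldNormedType.Exports.

Local Open Scope classical_set_scope.
Local Open Scope complex_scope.
Local Open Scope ring_scope.

(** * Banach lattices *)

(* The order is a field of the structure: the library's ordered types cannot be
   joined with its normed modules by inheritance. *)
HB.mixin Record CompleteNormedModule_isBanachLattice (R : realType) E
    of CompleteNormedModule R E := {
  blat_le : E -> E -> Prop ;
  blat_le_refl : forall x : E, blat_le x x ;
  blat_le_anti : forall x y : E, blat_le x y -> blat_le y x -> x = y ;
  blat_le_trans : forall x y z : E, blat_le x y -> blat_le y z -> blat_le x z ;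
  blat_leD2r : forall x y z : E, blat_le x y -> blat_le (x + z) (y + z) ;
  blat_scale_ge0 : forall (a : R) (x : E),
    0 <= a -> blat_le 0 x -> blat_le 0 (a *: x) ;
  (* Binary suprema suffice: the infimum of x and y is - sup(- x, - y). *)
  blat_sup : E -> E -> E ;
  blat_le_supl : forall x y : E, blat_le x (blat_sup x y) ;
  blat_le_supr : forall x y : E, blat_le y (blat_sup x y) ;
  blat_sup_le : forall x y z : E,
    blat_le x z -> blat_le y z -> blat_le (blat_sup x y) z ;
  (* |x| <= |y| implies ||x|| <= ||y||, where |x| = sup(x, - x). *)
  blat_le_norm : forall x y : E,
    blat_le (blat_sup x (- x)) (blat_sup y (- y)) -> `|x| <= `|y|
}.

#[short(type="banachLatticeType")]
HB.structure Definition BanachLattice (R : realType) :=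
  { E of CompleteNormedModule R E & CompleteNormedModule_isBanachLattice R E }.

Definition AM_space (R : realType) (E : banachLatticeType R) : Prop :=
  forall f g : E, blat_le 0 f -> blat_le 0 g ->
    `|blat_sup f g| = Num.max `|f| `|g|.

(* [m] is the modulus of x + iy, i.e. the supremum over all real theta of
   Re (e^(- i theta) (x + iy)). *)
Definition is_modulus (R : realType) (E : banachLatticeType R) (x y m : E) :=
  (forall theta : R, blat_le (cos theta *: x + sin theta *: y) m) /\
  (forall u : E,
    (forall theta : R, blat_le (cos theta *: x + sin theta *: y) u) ->
    blat_le m u).

(* A complex Banach lattice is the complexification of a real one, its real
   part, normed by ||z|| = || |z| ||.  The modulus exists for all x and y in a
   real Banach lattice, so the existential in [cblat_norm] is no restriction. *)
Record complexBanachLattice (R : realType) := ComplexBanachLattice {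
  cblat_sort :> completeNormedModType R[i] ;
  cblat_re : banachLatticeType R ;
  cblat_inj : cblat_re -> cblat_sort ;
  cblat_injD : forall x y : cblat_re,
    cblat_inj (x + y) = cblat_inj x + cblat_inj y ;
  cblat_injZ : forall (a : R) (x : cblat_re),
    cblat_inj (a *: x) = a%:C *: cblat_inj x ;
  cblat_decomp : forall z : cblat_sort, exists x y : cblat_re,
    z = cblat_inj x + 'i%C *: cblat_inj y ;
  cblat_decomp_inj : forall x y x' y' : cblat_re,
    cblat_inj x + 'i%C *: cblat_inj y = cblat_inj x' + 'i%C *: cblat_inj y' ->
    x = x' /\ y = y' ;
  cblat_norm : forall x y : cblat_re, exists2 m : cblat_re,
    is_modulus x y m & `|cblat_inj x + 'i%C *: cblat_inj y| = `|m|%:C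
}.

(** * One-parameter semigroups

   [K] is the scalar field, R or R[i], and [rho] the embedding of R into it.
   A semigroup is a family indexed by R of which only the values at t >= 0
   are ever used. *)

Section Semigroups.
Context (R : realType) (K : numFieldType) (rho : {rmorphism R -> K}).
Context (V : completeNormedModType K).
Implicit Type T : R -> V -> V.

Definition C0_semigroup T : Prop :=
  [/\ forall t, 0 <= t -> linear (T t) /\ continuous (T t),
      forall x, T 0 x = x,
      forall s t x, 0 <= s -> 0 <= t -> T (s + t) x = T s (T t x) &
      forall x, T t x @[t --> (0 : R)^'+] --> x ].

Definition positive_semigroup (C : set V) T : Prop :=
  forall (t : R) (f : V), 0 <= t -> C f -> C (T t f).

Definition bounded_semigroup T : Prop :=
  exists M : R, forall (t : R) (x : V), 0 <= t -> `|T t x| <= rho M * `|x|.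

Definition growth_bound T : \bar R :=
  ereal_inf [set w%:E | w in
    [set w : R | bounded_semigroup (fun t x => rho (expR (- w * t)) *: T t x)]].

End Semigroups.

(** * Unbounded operators and their spectrum *)

(* Only the values of [op_fun] on [op_dom] are meaningful. *)
Record unbounded_op (V : Type) := UnboundedOp {
  op_dom : set V ;
  op_fun :> V -> V
}.

Definition generator (R : realType) (K : numFieldType)
    (rho : {rmorphism R -> K}) (V : completeNormedModType K)
    (T : R -> V -> V) : unbounded_op V :=
  let quotient (x : V) (h : R) := rho h^-1 *: (T h x - x) in
  UnboundedOp [set x | cvg (quotient x h @[h --> (0 : R)^'+])]
              (fun x => lim (quotient x h @[h --> (0 : R)^'+])).

Section Spectrum.
Context (R : realType) (V : preTopologicalLmodType R[i]).
Implicit Type A : unbounded_op V.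

Definition resolvent_set A : set R[i] :=
  [set lambda | exists S : V -> V,
    [/\ continuous S,
        forall f, op_dom A (S f) /\ lambda *: S f - A (S f) = f &
        forall x, op_dom A x -> S (lambda *: x - A x) = x ]].

Definition spectrum A : set R[i] := ~` resolvent_set A.

Definition spectral_bound A : \bar R :=
  ereal_sup [set (complex.Re lambda)%:E | lambda in spectrum A].

End Spectrum.

(** * Complexification *)

(* The pair (x, y) stands for x + iy.  Boundedness of the resolvent operators
   only depends on the topology, which is the product topology for each of the
   (equivalent) complexified norms. *)
Definition complexification (R : realType) (E : completeNormedModType R) :
  Type := (E * E)%type.

Section Complexification.
Context (R : realType) (E : completeNormedModType R).
Local Notation EC := (complexification E).

HB.instance Definition _ := GRing.Zmodule.copy EC (E * E)%type.
HB.instance Definition _ := Topological.copy EC (E * E)%type.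

Definition complexification_scale (c : R[i]) (z : EC) : EC :=
  (complex.Re c *: z.1 - complex.Im c *: z.2,
   complex.Re c *: z.2 + complex.Im c *: z.1).

Fact complexification_scaleA a b z :
  complexification_scale a (complexification_scale b z) =
  complexification_scale (a * b) z.
Proof.
case: a b z => [a1 a2] [b1 b2] [x y]; rewrite /complexification_scale /=.
congr pair;
  rewrite !(scalerBr, scalerDr, scalerBl, scalerDl) !scalerA ?opprD -!addrA;
  congr (_ + _).
  by rewrite [RHS]addrC addrA.
by rewrite addrA addrC.
Qed.

Fact complexification_scale1 : left_id 1 complexification_scale.
Proof.
by case=> x y; rewrite /complexification_scale /= !scale1r !scale0r subr0 addr0.
Qed.

Fact complexification_scaleDr : right_distributive complexification_scale +%R.
Proof.
move=> [a1 a2] [x y] [x' y']; rewrite /complexification_scale /=.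
by congr pair => /=; rewrite !scalerDr ?opprD addrACA.
Qed.

Fact complexification_scaleDl z :
  {morph complexification_scale^~ z : a b / a + b}.
Proof.
case: z => x y [a1 a2] [b1 b2]; rewrite /complexification_scale /=.
by congr pair => /=; rewrite !scalerDl ?opprD addrACA.
Qed.

HB.instance Definition _ := GRing.Zmodule_isLmodule.Build R[i] EC
  complexification_scaleA complexification_scale1
  complexification_scaleDr complexification_scaleDl.

Definition complexify_op (A : unbounded_op E) : unbounded_op EC :=
  UnboundedOp [set z : EC | op_dom A z.1 /\ op_dom A z.2]
              (fun z : EC => (A z.1, A z.2) : EC).

End Complexification.

(* Main.v *)
Require Import Defs.
From HB Require Import structures.
From mathcomp Require Import all_boot all_order all_algebra.
From mathcomp Require Import all_classical all_reals all_analysis.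
From mathcomp Require Import ring lra.

Set Implicit Arguments.
Unset Strict Implicit.
Unset Printing Implicit Defensive.

Import Order.TTheory GRing.Theory Num.Theory.
Import numFieldNormedType.Exports.

Local Open Scope classical_set_scope.
Local Open Scope complex_scope.
Local Open Scope ring_scope.

(** The theorem consists of two inequalities.

   s(A) <= omega_0(A) holds on every Banach space: if e^(- w t) T t is bounded
   and Re l > w, then the Laplace transform of T at l inverts l - A
   ([resolvent_right_half_plane]).  For a semigroup that decays exponentially,
   the integral of an orbit over the half-line is obtained as the limit of the
   Riemann sums h * \sum_(k < n) T (k h) f, where h -> 0 and n h -> +oo; the
   semigroup law alone gives their convergence and the identities that the
   integral satisfies.  A complex l = a + ib is handled by letting
   e^(- l t) T t act on E * E, seen as a real Banach space.

   omega_0(A) <= s(A) uses the order.  Let w > s(A).  The resolvent at l is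
   positive for large real l, as a Laplace transform, and positivity descends
   to l = w because it persists for slightly smaller parameters, by a step
   that depends only on the norm of the resolvent ([resolvent_pos]).  After
   multiplying T t by e^(- w t) one may take w = 0; let S be the inverse of
   - A, a positive operator.  For g >= 0, S g - T t (S g) is the integral of
   T s g over 0 <= s <= t.  It is positive, and so is T t (S g), so all these
   integrals and all the vectors T t (S g) are below S g.
   Let now f >= 0, and let g be the supremum of T s f over 0 <= s <= 1.  For
   t >= 1, T t f is the mean over 0 <= s <= 1 of T (t - 1 + s) (T (1 - s) f),
   hence it is at most the integral of T (t - 1 + s) g, which is T (t - 1)
   applied to an integral of T s g, hence at most S g.  In an AM-space the
   norm of g is at most the supremum of the norms of the T s f.  Therefore
   the norm of T t f is bounded by a multiple of that of f, uniformly in t,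
   and omega_0(A) <= w.  In the proof g is the supremum over the finitely many
   times i/N, and N tends to infinity ([orbit_dominated], [bounded_on_cone]).

   A complex Banach lattice is homeomorphic to the complexification of its
   real part.  A positive semigroup maps the real part into itself, and the
   restriction has the same growth bound and the same spectrum
   ([growth_bound_of_parts], [spectrum_of_parts]); this reduces the complex
   case to the real one. *)

(** * Limits and right derivatives at zero *)

Section Norm_limits.
Context (R : realType) (V : normedModType R) (U : Type) (F : set_system U).

Lemma cvg_norm_le {FF : Filter F} (f : U -> V) (l : V) (r : U -> R) :
  (\forall k \near F, `|f k - l| <= r k) -> r k @[k --> F] --> 0 ->
  f k @[k --> F] --> l.
Proof.
move=> fr /cvgr0Pnorm_le r0; apply/cvgrPdist_le => e e0.
near=> k; rewrite distrC; apply: le_trans (_ : r k <= e); first by near: k.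
by apply: le_trans (ler_norm _) _; near: k; exact: (r0 e e0).
Unshelve. all: by end_near. Qed.

Lemma norm_lim_le {FF : ProperFilter F} (f : U -> V) (l : V) (r : U -> R) a :
  f k @[k --> F] --> l -> (\forall k \near F, `|f k| <= r k) ->
  r k @[k --> F] --> a -> `|l| <= a.
Proof.
move=> /cvg_norm fl fr ra.
have h : r k - `|f k| @[k --> F] --> a - `|l| by exact: cvgB.
rewrite -subr_ge0 -(cvg_lim _ h)//; apply: limr_ge; first by apply: cvgP h.
by near=> k; rewrite /= subr_ge0; near: k.
Unshelve. all: by end_near. Qed.

End Norm_limits.

Section Right_limits.
Context (R : realType).
Implicit Types (a b h : R).

(** Limits at 0 from the right may thus be evaluated along steps that
   divide a given length exactly. *)
Lemma near_divisor (P : R -> Prop) h : 0 < h -> (\forall k \near 0^'+, P k) ->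
  exists2 m, (0 < m)%N & P (h / m%:R).
Proof.
move=> h0 [z /= z0 Pz]; exists (Num.trunc (h / z)).+1 => //.
have /andP[_] := @trunc_itv R (h / z) (divr_ge0 (ltW h0) (ltW z0)).
set m := _.+1 => hm; have m0 : 0 < m%:R :> R by rewrite ltr0n.
have hm0 : 0 < h / m%:R by rewrite divr_gt0.
apply: Pz => //=; rewrite sub0r normrN gtr0_norm//.
by rewrite ltr_pdivrMr// mulrC -ltr_pdivrMr.
Qed.

Lemma right_derivative (f : R -> R) (df : R) :
  is_derive (0 : R) 1 f df -> h^-1 * (f h - f 0) @[h --> (0 : R)^'+] --> df.
Proof.
move=> [fd <-]; apply: cvg_dnbhs_at_right.
have : h^-1 *: ((f \o shift 0) (h *: (1 : R)) - f 0) @[h --> 0^'] --> 'D_1 f 0.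
  exact: fd.
apply: cvg_trans; apply: near_eq_cvg; near=> h.
by rewrite /= addr0 [h *: 1]mulr1.
Unshelve. all: by end_near. Qed.

Lemma derive_scale a : is_derive (0 : R) 1 ( *%R a) a.
Proof.
have := @is_deriveZ R R R id a 0 1 1 (is_derive_id _ _).
by rewrite [a *: 1]mulr1.
Qed.

Lemma expcos_right_derivative a b :
  h^-1 * (expR (a * h) * cos (b * h) - 1) @[h --> (0 : R)^'+] --> a.
Proof.
have e := is_derive1_comp (is_derive_expR (a * 0)) (derive_scale a).
have c := is_derive1_comp (is_derive_cos (b * 0)) (derive_scale b).
have H : is_derive (0 : R) 1 (fun h => expR (a * h) * cos (b * h)) a.
  apply: is_derive_eq (is_deriveM e c) _ => /=.
  rewrite !mulr0 expR0 cos0 sin0 oppr0 mul0r scaler0 add0r mul1r.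
  exact: scale1r.
by have := right_derivative H; rewrite !mulr0 expR0 cos0 mulr1.
Qed.

Lemma expsin_right_derivative a b :
  h^-1 * (expR (a * h) * sin (b * h)) @[h --> (0 : R)^'+] --> b.
Proof.
have e := is_derive1_comp (is_derive_expR (a * 0)) (derive_scale a).
have c := is_derive1_comp (is_derive_sin (b * 0)) (derive_scale b).
have H : is_derive (0 : R) 1 (fun h => expR (a * h) * sin (b * h)) b.
  apply: is_derive_eq (is_deriveM e c) _ => /=.
  rewrite !mulr0 expR0 cos0 sin0 scale0r addr0 mul1r.
  exact: scale1r.
have := right_derivative H; rewrite !mulr0 expR0 sin0 mulr0.
by under eq_fun do rewrite subr0.
Qed.

(** The difference is h times a convergent quotient. *)
Lemma right_continuous_of_derivative (p : R -> R) (c d : R) :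
  h^-1 * (p h - c) @[h --> (0 : R)^'+] --> d -> p h @[h --> (0 : R)^'+] --> c.
Proof.
move=> pd; have : h * (h^-1 * (p h - c)) + c @[h --> (0 : R)^'+] --> 0 * d + c.
  apply: cvgD; last exact: cvg_cst.
  by apply: cvgM => //; apply: cvg_within_filter; exact: cvg_id.
rewrite mul0r add0r; apply: cvg_trans; apply: near_eq_cvg; near=> h.
have h0 : 0 < h by [].
by rewrite mulrA divff ?mul1r ?subrK// gt_eqF.
Unshelve. all: by end_near. Qed.

Lemma exp_right_derivative a :
  h^-1 * (expR (a * h) - 1) @[h --> (0 : R)^'+] --> a.
Proof.
have := @expcos_right_derivative a 0.
by under eq_fun do rewrite mul0r cos0 mulr1.
Qed.

End Right_limits.

(** * Laplace transform of an exponentially stable semigroup *)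

(** The graph of the generator: A x = y. *)
Definition has_generator (R : realType) (V : normedModType R) (T : R -> V -> V)
    (x y : V) : Prop :=
  h^-1 *: (T h x - x) @[h --> 0^'+] --> y.

(** The space is any normed module, so that E * E is an instance; completeness
   is a hypothesis of the lemmas that take limits. *)
Record stable_semigroup (R : realType) (V : normedModType R)
    (T : R -> V -> V) (M d : R) : Prop := StableSemigroup {
  stable_linear : forall t : R, 0 <= t -> linear (T t) ;
  stable0 : forall x, T 0 x = x ;
  stableD : forall (s t : R) x, 0 <= s -> 0 <= t -> T (s + t) x = T s (T t x) ;
  stable_cvg : forall x, T t x @[t --> 0^'+] --> x ;
  stable_bound : forall (t : R) x, 0 <= t ->
    `|T t x| <= M * expR (- (d * t)) * `|x|
}.

Section Laplace.
Context (R : realType) (V : normedModType R).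
Hypothesis Vcomplete :
  forall F : set_system V, ProperFilter F -> cauchy F -> cvg F.
Context (T : R -> V -> V) (M d : R).
Hypotheses (M_gt0 : 0 < M) (d_gt0 : 0 < d) (ssgT : stable_semigroup T M d).

Implicit Types (s t h e a z : R) (x y f g : V) (n m k p q : nat).

Let T0 := stable0 ssgT.
Let TD := stableD ssgT.
Let Tcvg := stable_cvg ssgT.
Let Tbound := stable_bound ssgT.

Let TDl t x y : 0 <= t -> T t (x + y) = T t x + T t y.
Proof.
by move=> /(stable_linear ssgT) tl; have := tl 1 x y; rewrite !scale1r.
Qed.

Let T_0 t : 0 <= t -> T t 0 = 0.
Proof. by move=> t0; apply: (addIr (T t 0)); rewrite -TDl// !add0r. Qed.

Let TZ t a x : 0 <= t -> T t (a *: x) = a *: T t x.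
Proof.
move=> t0; have := stable_linear ssgT t0 a x 0.
by rewrite addr0 T_0// addr0.
Qed.

Let TN t x : 0 <= t -> T t (- x) = - T t x.
Proof. by move=> t0; rewrite -scaleN1r TZ// scaleN1r. Qed.

Let TB t x y : 0 <= t -> T t (x - y) = T t x - T t y.
Proof. by move=> t0; rewrite TDl// TN. Qed.

Let T_sum t n (F : 'I_n -> V) : 0 <= t ->
  T t (\sum_(k < n) F k) = \sum_(k < n) T t (F k).
Proof.
move=> t0; apply: (big_morph (T t)); last exact: T_0.
by move=> x y; exact: TDl.
Qed.

Let TleM t x : 0 <= t -> `|T t x| <= M * `|x|.
Proof.
move=> t0; apply: le_trans (Tbound x t0) _; rewrite ler_wpM2r//.
by rewrite ger_pMr// -expR0 ler_expR oppr_le0 mulr_ge0// ltW.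
Qed.

Let TC s t x : 0 <= s -> 0 <= t -> T s (T t x) = T t (T s x).
Proof. by move=> s0 t0; rewrite -!TD// addrC. Qed.

(** A Riemann sum for the integral of the orbit of f over [0, n h]. *)
Definition riemann (h : R) (n : nat) (f : V) : V :=
  h *: \sum_(k < n) T (k%:R * h) f.

Let kh0 k h : 0 < h -> 0 <= k%:R * h.
Proof. by move=> h0; rewrite mulr_ge0// ltW. Qed.

Lemma riemann_cat h q p f : 0 < h ->
  riemann h (q + p) f = riemann h q f + T (q%:R * h) (riemann h p f).
Proof.
move=> h0; rewrite /riemann big_split_ord/= scalerDr TZ ?kh0// T_sum ?kh0//.
congr (_ + _ *: _); apply: eq_bigr => i _.
by rewrite -TD ?kh0// -mulrDl -natrD.
Qed.

Lemma riemann1 h f : riemann h 1 f = h *: f.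
Proof. by rewrite /riemann big_ord1 mul0r T0. Qed.

Lemma riemann_commute h n t f : 0 < h -> 0 <= t ->
  riemann h n (T t f) = T t (riemann h n f).
Proof.
move=> h0 t0; rewrite /riemann TZ// T_sum//; congr (_ *: _).
by apply: eq_bigr => i _; rewrite TC ?kh0.
Qed.

Lemma riemannB h n f g : 0 < h ->
  riemann h n (f - g) = riemann h n f - riemann h n g.
Proof.
move=> h0; rewrite /riemann -scalerBr -sumrB; congr (_ *: _).
by apply: eq_bigr => i _; rewrite TB ?kh0.
Qed.

Lemma riemannZ h n a f : 0 < h -> riemann h n (a *: f) = a *: riemann h n f.
Proof.
move=> h0; rewrite /riemann scalerA mulrC -scalerA; congr (_ *: _).
rewrite scaler_sumr.
by apply: eq_bigr => i _; rewrite TZ ?kh0.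
Qed.

(** Both sides are the sum over [0, (m + p) h] cut in two ways; this is the
   discrete form of A applied to an integral of the orbit. *)
Lemma riemann_exchange h m p f : 0 < h ->
  riemann h p f - T (m%:R * h) (riemann h p f) =
  riemann h m f - T (p%:R * h) (riemann h m f).
Proof.
move=> h0; have := riemann_cat m p f h0.
rewrite [(m + p)%N]addnC riemann_cat// => e.
by apply/eqP; rewrite subr_eq addrAC eq_sym subr_eq -e.
Qed.

(** Refining the step m times replaces f by its mean over one coarse step. *)
Lemma riemann_mul h n m f : 0 < h -> (0 < m)%N ->
  riemann h (n * m) f = riemann (m%:R * h) n ((m%:R * h)^-1 *: riemann h m f).
Proof.
move=> h0 m0.
have mh0 : 0 < m%:R * h by rewrite mulr_gt0// ltr0n.
elim: n => [|n IH]; first by rewrite mul0n /riemann !big_ord0 !scaler0.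
rewrite mulSnr -addn1 !riemann_cat// IH; congr (_ + _).
rewrite riemann1 scalerA divff ?scale1r ?gt_eqF//.
by rewrite natrM mulrA.
Qed.

Definition riemann_constant := M * (1 + d^-1).
Local Notation C := riemann_constant.

Let C0 : 0 < C.
Proof. by rewrite mulr_gt0// addr_gt0// invr_gt0. Qed.

(** The bound is uniform in the number of nodes: it is the geometric sum
   h M / (1 - e^(- d h)), estimated with e^(d h) >= 1 + d h. *)
Lemma riemann_norm h n f : 0 < h -> h <= 1 -> `|riemann h n f| <= C * `|f|.
Proof.
move=> h0 h1; rewrite /riemann normrZ gtr0_norm//.
set r := expR (- (d * h)).
have r0 : 0 < r by exact: expR_gt0.
have r1 : r < 1 by rewrite -expR0 ltr_expR oppr_lt0 mulr_gt0.
have powr k : expR (- (d * (k%:R * h))) = r ^+ k.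
  by rewrite /r -expRM_natl mulrN; congr (expR (- _)); ring.
have hr : h <= (1 + d^-1) * (1 - r).
  have r2 : r * (1 + d * h) <= 1.
    by rewrite -ler_pdivlMl// mulr1 /r expRN invrK expR_ge1Dx.
  have dd : d * d^-1 = 1 by rewrite divff// gt_eqF.
  have di0 : 0 < d^-1 by rewrite invr_gt0.
  have dr2 : r * (d^-1 + h) <= d^-1.
    have -> : d^-1 + h = d^-1 * (1 + d * h)
      by rewrite mulrDr mulr1 mulrA mulVf ?mul1r// gt_eqF.
    by rewrite mulrCA ger_pMr.
  have : r * h <= r by rewrite ger_pMr.
  nra.
have -> : C * `|f| = (1 + d^-1) * (M * `|f|) by rewrite /C; ring.
apply: le_trans (_ : h * \sum_(k < n) (M * `|f|) * r ^+ k <= _).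
  rewrite ler_wpM2l ?(ltW h0)//; apply: le_trans (ler_norm_sum _ _ _) _.
  apply: ler_sum => i _; apply: le_trans (Tbound f (kh0 i h0)) _.
  by rewrite powr mulrAC.
rewrite -mulr_sumr mulrCA (mulrC _ (M * _)) ler_wpM2l ?mulr_ge0 ?(ltW M_gt0)//.
have sr : (1 - r) * \sum_(k < n) r ^+ k <= 1.
  by rewrite -opprB mulNr -subrX1 opprB lerBlDr lerDl exprn_ge0// ltW.
have s0 : 0 <= \sum_(k < n) r ^+ k.
  by apply: sumr_ge0 => i _; rewrite exprn_ge0// ltW.
apply: le_trans (ler_wpM2r s0 hr) _.
by rewrite -mulrA ler_piMr// addr_ge0// invr_ge0 ltW.
Qed.

(** T t f - T s f = T s (T (t - s) f - f) and the operators T s are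
   uniformly bounded, so right continuity at 0 is all that matters. *)
Lemma semigroup_equicontinuous f e : 0 < e -> exists2 z : R, 0 < z &
  forall s t, 0 <= s -> 0 <= t -> `|s - t| < z -> `|T s f - T t f| <= e.
Proof.
move=> e0; have eM : 0 < e / M by rewrite divr_gt0.
have /cvgrPdist_le/(_ _ eM)[z /= z0 Hz] := @Tcvg f.
have osc s : 0 <= s -> s < z -> `|T s f - f| <= e / M.
  rewrite le_eqVlt => /predU1P[<- _|s0 sz].
    by rewrite T0 subrr normr0 ltW.
  by rewrite distrC; apply: Hz => //=; rewrite sub0r normrN gtr0_norm.
exists z => // s t s0 t0.
wlog st : s t s0 t0 / s <= t.
  move=> H; have [/H|/ltW ts] := leP s t; first exact.
  by rewrite distrC => stz; rewrite distrC; exact: H.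
rewrite distrC ger0_norm ?subr_ge0// => stz.
have {1}-> : t = s + (t - s) by rewrite addrC subrK.
rewrite TD ?subr_ge0// -TB//; apply: le_trans (TleM _ s0) _.
by rewrite -ler_pdivlMl// mulrC distrC osc// subr_ge0.
Qed.

Lemma riemann_near h m f e : 0 < h ->
  (forall s, 0 <= s <= m%:R * h -> `|T s f - f| <= e) ->
  `|riemann h m f - (m%:R * h) *: f| <= m%:R * h * e.
Proof.
move=> h0 fe; rewrite mulrC -scalerA -scalerBr normrZ gtr0_norm// -mulrA.
rewrite ler_wpM2l ?(ltW h0)//.
have -> : m%:R *: f = \sum_(k < m) f by rewrite sumr_const card_ord scaler_nat.
rewrite -sumrB; apply: le_trans (ler_norm_sum _ _ _) _.
have -> : m%:R * e = \sum_(k < m) e by rewrite sumr_const card_ord mulr_natl.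
apply: ler_sum => k _; apply: fe; rewrite kh0//= ler_wpM2r ?(ltW h0)// ler_nat.
exact: ltnW.
Qed.

Lemma riemann_continuous h n f : 0 < h ->
  riemann s n f @[s --> h] --> riemann h n f.
Proof.
move=> h0; apply: cvgZ; first exact: cvg_id.
apply: cvg_big => [|k _]; first exact: add_continuous.
apply/cvgrPdist_le => e e0.
have [z z0 Hz] := semigroup_equicontinuous f e0.
have zk : 0 < z / k.+1%:R by rewrite divr_gt0// ltr0n.
near=> s; have s0 : 0 < s by near: s; exact: lt_nbhsr.
apply: Hz; rewrite ?kh0// -mulrBr normrM ger0_norm//.
apply: le_lt_trans (_ : k.+1%:R * `|h - s| < z).
  by rewrite ler_wpM2r// ler_nat.
rewrite -ltr_pdivlMl ?ltr0n// mulrC; near: s.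
exact: cvgr_dist_lt.
Unshelve. all: by end_near. Qed.

(** About h^-2 nodes for the step h: the Riemann sum then covers an interval
   of length at least h^-1, so that one limit h -> 0 both refines the sum and
   exhausts the half-line. *)
Definition nodes (h : R) : nat := (Num.trunc (h^-1 ^+ 2)).+1.

Lemma nodes_gt h : 0 < h -> h^-1 <= (nodes h)%:R * h.
Proof.
move=> h0; rewrite -ler_pdivrMr// -expr2.
have /andP[_ /ltW] := @trunc_itv R (h^-1 ^+ 2) (sqr_ge0 _).
by [].
Qed.

Definition laplace_approx f h := riemann h (nodes h) f.

Lemma decay_cvg a : 0 < a -> expR (- (d * h^-1)) * a @[h --> 0^'+] --> 0.
Proof.
move=> a0; apply/cvgrPdist_le => e e0; near=> h.
have h0 : 0 < h by [].
have dh : 0 < d * h^-1 by rewrite mulr_gt0// invr_gt0.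
rewrite sub0r normrN ger0_norm ?mulr_ge0 ?expR_ge0 ?(ltW a0)//.
rewrite expRN ler_pdivrMl ?expR_gt0//.
apply: le_trans (_ : d * h^-1 * e <= _); last first.
  rewrite ler_wpM2r ?(ltW e0)//; apply: le_trans (expR_ge1Dx _).
  by rewrite lerDr.
rewrite mulrAC ler_pdivlMr//.
have -> : a * h = h * a by rewrite mulrC.
rewrite -ler_pdivlMr//; near: h; apply: nbhs_right_le.
by rewrite divr_gt0// mulr_gt0.
Unshelve. all: by end_near. Qed.

(** The nodes after the q-th contribute T (q h) applied to another Riemann
   sum, hence decay with q h. *)
Lemma laplace_approx_tail h q p f : 0 < h -> h <= 1 ->
  `|riemann h (q + p) f - riemann h q f| <=
  expR (- (d * (q%:R * h))) * (M * (C * `|f|)).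
Proof.
move=> h0 h1; rewrite riemann_cat// addrC addKr.
apply: le_trans (Tbound _ (kh0 q h0)) _.
rewrite mulrAC [leRHS]mulrC ler_wpM2r ?expR_ge0// ler_wpM2l ?(ltW M_gt0)//.
exact: riemann_norm.
Qed.

(** By [riemann_mul] the two sums differ by a sum applied to the deviation of
   f from its mean over one coarse step. *)
Lemma riemann_refine (k : R) m n f e : 0 < k -> (0 < m)%N -> m%:R * k <= 1 ->
  (forall s, 0 <= s <= m%:R * k -> `|T s f - f| <= e) ->
  `|riemann k (n * m) f - riemann (m%:R * k) n f| <= C * e.
Proof.
move=> k0 m0 mk1 fe; have mk0 : 0 < m%:R * k by rewrite mulr_gt0// ltr0n.
rewrite riemann_mul// -riemannB//; apply: le_trans (riemann_norm _ _ mk0 mk1) _.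
rewrite ler_wpM2l ?(ltW C0)//.
have -> : f = (m%:R * k)^-1 *: ((m%:R * k) *: f).
  by rewrite scalerA mulVf ?scale1r// gt_eqF.
rewrite [X in riemann _ _ X]scalerA mulVf ?scale1r ?gt_eqF//.
rewrite -scalerBr normrZ gtr0_norm ?invr_gt0// ler_pdivrMl//.
exact: riemann_near.
Qed.

(** A fixed Riemann sum with step h and n nodes approximates all sums of much
   smaller step k.  The coarse step h is first moved to the nearest multiple
   m k below it; the three terms bound the tail, the refinement of m k into k,
   and the move from h to m k. *)
Lemma laplace_approx_near h n f e z : 0 < h -> h <= 1 -> 0 < z ->
  (forall s, 0 <= s <= h -> `|T s f - f| <= e) ->
  \forall k \near 0^'+, `|laplace_approx f k - riemann h n f| <=
    expR (- (d * (n%:R * (h / 2)))) * (M * (C * `|f|)) + C * e + z.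
Proof.
move=> h0 h1 z0 fe.
have /cvgrPdist_le/(_ _ z0)/nbhs_ballP[r /= r0 Hr] :=
  @riemann_continuous h n f h0.
near=> k; have k0 : 0 < k by [].
have hk0 : 0 <= h / k by rewrite divr_ge0// ltW.
pose m := Num.trunc (h / k).
have /andP[mle mgt] := trunc_itv hk0; rewrite -/m in mle mgt.
have mkh : m%:R * k <= h by rewrite -ler_pdivlMr.
have hmk : h - k < m%:R * k.
  by rewrite ltrBlDr; have := mgt; rewrite -natr1 ltr_pdivrMr// mulrDl mul1r.
have kh2 : k <= h / 2 by near: k; apply: nbhs_right_le; rewrite divr_gt0.
have h2mk : h / 2 <= m%:R * k by lra.
have m0 : (0 < m)%N.
  rewrite lt0n; apply/eqP => m0; move: h2mk; rewrite m0 mul0r; lra.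
have k1 : k <= 1 by lra.
have nmk : (n * m <= nodes k)%N.
  rewrite -(@ler_nat R); apply: le_trans (_ : k^-1 ^+ 2 <= _); last first.
    by have /andP[_ /ltW] := @trunc_itv R (k^-1 ^+ 2) (sqr_ge0 _).
  rewrite natrM; apply: le_trans (_ : n%:R * (h / k) <= _).
    by rewrite ler_wpM2l.
  rewrite mulrA expr2 ler_wpM2r// ?invr_ge0 ?(ltW k0)//.
  apply: le_trans (_ : n.+1%:R * h <= _).
    by rewrite ler_wpM2r ?(ltW h0)// ler_nat.
  rewrite -[leLHS]invrK lef_pV2 ?posrE ?invr_gt0 ?mulr_gt0 ?ltr0n//.
  near: k; apply: nbhs_right_le.
  by rewrite invr_gt0 mulr_gt0 ?ltr0n.
rewrite (_ : _ - _ =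
   (riemann k (n * m + (nodes k - n * m)) f - riemann k (n * m) f)
   + (riemann k (n * m) f - riemann (m%:R * k) n f)
   + (riemann (m%:R * k) n f - riemann h n f)); last first.
  by rewrite subnKC// -addrA (addrA (_ - riemann _ _ _)) !subrKA.
apply: le_trans (ler_normD _ _) (lerD _ _).
  apply: le_trans (ler_normD _ _) (lerD _ _).
    apply: le_trans (laplace_approx_tail _ _ _ k0 k1) _.
    apply: ler_wpM2r; first by rewrite mulr_ge0 ?(ltW M_gt0)// mulr_ge0// ltW.
    rewrite ler_expR lerN2.
    by rewrite ler_wpM2l ?(ltW d_gt0)// natrM -mulrA ler_wpM2l.
  apply: riemann_refine => //; first exact: le_trans h1.
  by move=> s /andP[s0 sm]; apply: fe; rewrite s0 (le_trans sm).
rewrite distrC; apply: Hr; rewrite -ball_normE /ball_/= ger0_norm ?subr_ge0//.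
have kr : k < r by near: k; apply: nbhs_right_lt.
by lra.
Unshelve. all: by end_near. Qed.

Lemma orbit_near_start f e : 0 < e -> exists2 z : R, 0 < z &
  forall h, 0 < h -> h < z -> forall s, 0 <= s <= h -> `|T s f - f| <= e.
Proof.
move=> e0; have [z z0 Hz] := semigroup_equicontinuous f e0; exists z => //.
move=> h h0 hz s /andP[s0 sh]; rewrite -{2}(T0 f); apply: Hz => //.
by rewrite subr0 ger0_norm// (le_lt_trans sh).
Qed.

(** [laplace_approx_near] makes the sums a Cauchy filter, centered at a
   Riemann sum with small step and large number of nodes. *)
Lemma laplace_approx_cvg f : cvg (laplace_approx f k @[k --> 0^'+]).
Proof.
apply: Vcomplete; apply/cauchyP => e e0.
pose K := M * (C * `|f|) + 1.
have K0 : 0 < K.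
  by rewrite ltr_pwDr// mulr_ge0 ?(ltW M_gt0)// mulr_ge0// ltW.
have e40 : 0 < e / 4 by rewrite divr_gt0.
have [z z0 Hz] := orbit_near_start f (divr_gt0 e40 C0).
pose h := Num.min 1 (z / 2).
have h0 : 0 < h by rewrite lt_min ltr01/= divr_gt0.
have h1 : h <= 1 by rewrite ge_min lexx.
have hz : h < z.
  apply: le_lt_trans (_ : z / 2 < z); first by rewrite ge_min lexx orbT.
  by lra.
have [n nK] : exists n, expR (- (d * (n%:R * (h / 2)))) * K <= e / 4.
  have A0 : 0 < d * (h / 2) * (e / 4) by rewrite !mulr_gt0.
  exists (Num.trunc (K / (d * (h / 2) * (e / 4)))).+1.
  set N := _.+1.
  have /andP[_] := @trunc_itv R (K / (d * (h / 2) * (e / 4)))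
    (divr_ge0 (ltW K0) (ltW A0)).
  rewrite -/N ltr_pdivrMr// => KN.
  rewrite expRN mulrC ler_pdivrMr ?expR_gt0//.
  apply: le_trans (ltW KN) _; rewrite [leRHS]mulrC.
  have := @expR_ge1Dx R (d * (N%:R * (h / 2))); nra.
exists (riemann h n f).
have := laplace_approx_near n h0 h1 e40 (Hz h h0 hz).
apply: filterS => k; rewrite -ball_normE /ball_/= distrC => /le_lt_trans; apply.
have ee : C * (e / 4 / C) = e / 4 by rewrite mulrC divfK// gt_eqF.
rewrite ee; suff : expR (- (d * (n%:R * (h / 2)))) * (M * (C * `|f|)) <= e / 4
  by lra.
apply: le_trans nK; rewrite ler_wpM2l ?expR_ge0// lerDl//.
Qed.

(** The integral of T t f over [0, +oo), i.e. the inverse of - A at f. *)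
Definition laplace f := lim (laplace_approx f k @[k --> 0^'+]).

Lemma laplace_lim f : laplace_approx f k @[k --> 0^'+] --> laplace f.
Proof. exact: laplace_approx_cvg. Qed.

Lemma laplace_norm f : `|laplace f| <= C * `|f|.
Proof.
apply: (norm_lim_le (laplace_lim (f := f)) _ (cvg_cst (C * `|f|))).
near=> k; apply: riemann_norm => //; near: k; exact: nbhs_right_le.
Unshelve. all: by end_near. Qed.

Lemma laplaceB f g : laplace (f - g) = laplace f - laplace g.
Proof.
apply: cvg_unique (laplace_lim (f := f - g)) _ => //.
apply: cvg_trans (cvgB (laplace_lim (f := f)) (laplace_lim (f := g))).
apply: near_eq_cvg; near=> k; rewrite /laplace_approx riemannB//.
Unshelve. all: by end_near. Qed.

(** laplace f - T h (laplace f) is the integral of the orbit over [0, h].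
   For a step k dividing h this holds for the approximations, up to a tail,
   by [riemann_exchange]. *)
Lemma laplace_increment f h e : 0 < h ->
  (forall s, 0 <= s <= h -> `|T s f - f| <= e) ->
  `|(laplace f - T h (laplace f)) - h *: f| <= h * e.
Proof.
move=> h0 fe; apply/ler_addgt0Pl => z z0.
have e0 : 0 <= e by apply: le_trans (fe 0 _); rewrite ?normr_ge0// lexx ltW.
pose K := M * (`|h *: f| + h * e) + 1.
have K0 : 0 < K.
  by rewrite ltr_pwDr// mulr_ge0 ?(ltW M_gt0)// addr_ge0// mulr_ge0// ltW.
have z2 : 0 < z / 2 by rewrite divr_gt0.
have zM : 0 < z / 2 / (1 + M) by rewrite divr_gt0// addr_gt0.
have near_k : \forall k \near 0^'+,
    `|laplace f - laplace_approx f k| <= z / 2 / (1 + M) /\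
    expR (- (d * k^-1)) * K <= z / 2.
  have /cvgrPdist_le/(_ _ zM) H1 := @laplace_lim f.
  have /cvgrPdist_le/(_ _ z2) H2 := decay_cvg K0.
  near=> k; split; first by near: k.
  have : `|0 - expR (- (d * k^-1)) * K| <= z / 2 by near: k.
  by rewrite sub0r normrN ger0_norm// mulr_ge0 ?expR_ge0// ltW.
have [m m0 [Hm1 Hm2]] := near_divisor h0 near_k.
set k := h / m%:R in Hm1 Hm2.
have k0 : 0 < k by rewrite divr_gt0// ltr0n.
have mk : m%:R * k = h by rewrite mulrC divfK// gt_eqF// ltr0n.
set D := laplace f - laplace_approx f k in Hm1.
have -> : laplace f = laplace_approx f k + D by rewrite addrC subrK.
have approx_increment : laplace_approx f k - T h (laplace_approx f k) =
    riemann k m f - T ((nodes k)%:R * k) (riemann k m f).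
  by rewrite -{1}mk; exact: riemann_exchange.
rewrite TDl ?(ltW h0)// opprD addrACA approx_increment.
have rm : `|riemann k m f - h *: f| <= h * e.
  by rewrite -mk; apply: riemann_near => //; rewrite mk.
rewrite (_ : _ - _ = (riemann k m f - h *: f) + (D - T h D)
  - T ((nodes k)%:R * k) (riemann k m f)); last first.
  by rewrite addrAC [X in X + _ = _]addrAC [RHS]addrAC.
have DT : `|D - T h D| <= z / 2.
  apply: le_trans (ler_normB _ _) _.
  apply: le_trans (_ : `|D| + M * `|D| <= _).
    by rewrite lerD2l TleM// ltW.
  by rewrite -{1}(mul1r `|D|) -mulrDl mulrC -ler_pdivlMr// addr_gt0.
have tail : `|T ((nodes k)%:R * k) (riemann k m f)| <= z / 2.
  apply: le_trans (Tbound _ (kh0 (nodes k) k0)) _.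
  apply: le_trans Hm2; rewrite mulrAC mulrC.
  apply: ler_pM; rewrite ?expR_ge0 ?mulr_ge0 ?(ltW M_gt0)//.
    by rewrite ler_expR lerN2 ler_wpM2l ?(ltW d_gt0)// nodes_gt.
  apply: le_trans (_ : M * (`|h *: f| + h * e) <= _); last by rewrite lerDl.
  rewrite ler_wpM2l ?(ltW M_gt0)//.
  rewrite -[riemann k m f](subrK (h *: f)) addrC.
  by rewrite (le_trans (ler_normD _ _))// lerD2l.
apply: le_trans (ler_normB _ _) _.
have := ler_normD (riemann k m f - h *: f) (D - T h D); lra.
Unshelve. all: by end_near. Qed.

Lemma laplace_has_generator f : has_generator T (laplace f) (- f).
Proof.
apply/cvgrPdist_le => e e0; have [z z0 Hz] := orbit_near_start f e0.
near=> h; have h0 : 0 < h by [].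
have hz : h < z by near: h; exact: nbhs_right_lt.
have := laplace_increment h0 (Hz h h0 hz).
rewrite -ler_pdivrMl// -{1}(gtr0_norm h0) -normfV -normrZ scalerBr scalerA.
rewrite mulVf ?gt_eqF// scale1r -[in X in _ -> X]normrN opprB opprK.
by rewrite -[in X in X -> _]normrN opprB -scalerN opprB addrC.
Unshelve. all: by end_near. Qed.

(** If y = A x then y is close to (T h x - x) / h, on which the sum of step h
   telescopes to T (p h) x - x, with p the number of nodes. *)
Lemma laplace_generator x y : has_generator T x y -> laplace y = - x.
Proof.
move=> xy; apply/eqP; rewrite -subr_eq0 opprK -normr_eq0; apply/eqP/le_anti.
rewrite normr_ge0 andbT; apply/ler_addgt0Pl => e e0; rewrite addr0.
have e3 : 0 < e / 3 by rewrite divr_gt0.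
have eC : 0 < e / 3 / C by rewrite divr_gt0.
have K0 : 0 < M * `|x| + 1 by rewrite ltr_pwDr// mulr_ge0// ltW.
have /cvgrPdist_le/(_ _ eC) H1 := xy.
have /cvgrPdist_le/(_ _ e3) H2 := @laplace_lim y.
have /cvgrPdist_le/(_ _ e3) H3 := decay_cvg K0.
near (0 : R)^'+ => h; have h0 : 0 < h by [].
have h1 : h <= 1 by near: h; exact: nbhs_right_le.
have yq : `|y - h^-1 *: (T h x - x)| <= e / 3 / C by near: h.
set q := h^-1 *: (T h x - x) in yq.
have ly : `|laplace y - laplace_approx y h| <= e / 3 by near: h.
have dx : `|0 - expR (- (d * h^-1)) * (M * `|x| + 1)| <= e / 3 by near: h.
have lq : laplace_approx q h = T ((nodes h)%:R * h) x - x.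
  rewrite /laplace_approx riemannZ// riemannB// riemann_commute ?(ltW h0)//.
  have := @riemann_exchange h 1 (nodes h) x h0.
  rewrite mul1r riemann1 TZ ?kh0// -scalerBr => incr.
  by rewrite -opprB incr -scalerN scalerA mulVf ?gt_eqF// scale1r opprB.
have lyq : `|laplace_approx y h - laplace_approx q h| <= e / 3.
  rewrite -riemannB//; apply: le_trans (riemann_norm _ _ h0 h1) _.
  by rewrite mulrC -ler_pdivlMr.
have tx : `|T ((nodes h)%:R * h) x| <= e / 3.
  apply: le_trans dx; rewrite sub0r normrN.
  rewrite ger0_norm ?mulr_ge0 ?expR_ge0 ?(ltW K0)//.
  apply: le_trans (Tbound _ (kh0 (nodes h) h0)) _.
  rewrite mulrAC mulrC; apply: ler_pM;
    rewrite ?expR_ge0 ?mulr_ge0 ?(ltW M_gt0)//.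
    by rewrite ler_expR lerN2 ler_wpM2l ?(ltW d_gt0)// nodes_gt.
  by rewrite lerDl.
rewrite (_ : laplace y + x = (laplace y - laplace_approx y h) +
  (laplace_approx y h - laplace_approx q h) + T ((nodes h)%:R * h) x).
  apply: le_trans (ler_normD _ _) _.
  have := ler_normD (laplace y - laplace_approx y h)
    (laplace_approx y h - laplace_approx q h).
  lra.
by rewrite subrKA lq opprB addrA subrK.
Unshelve. all: by end_near. Qed.

End Laplace.

(** * Right half-planes in the resolvent set *)

Section Products.
Context (R : realType) (E : completeNormedModType R).

Lemma cvg_prodP (U : Type) (F : set_system U) {FF : Filter F} (f : U -> E * E)
    (z : E * E) :
  f k @[k --> F] --> z <->
  (f k).1 @[k --> F] --> z.1 /\ (f k).2 @[k --> F] --> z.2.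
Proof.
split=> [/cvgrPdist_le fz|[/cvgrPdist_le f1 /cvgrPdist_le f2]].
  split; apply/cvgrPdist_le => e /fz; apply: filterS => k;
    by rewrite prod_normE ge_max => /andP[].
apply/cvgrPdist_le => e e0; near=> k.
by rewrite prod_normE ge_max; apply/andP; split; near: k; [exact: f1|exact: f2].
Unshelve. all: by end_near. Qed.

Lemma prod_complete (F : set_system ((E * E)%type : normedModType R)) :
  ProperFilter F -> cauchy F -> cvg F.
Proof.
move=> FF /cauchyP Fc.
have c1 : cvg (z.1 @[z --> F]).
  apply: cauchy_cvg; apply/cauchyP => e /Fc[z ze]; exists z.1.
  change (F [set y : E * E | ball z.1 e y.1]).
  apply: filterS ze => y zy;
    have {zy} : ball_ Num.norm z e y by rewrite ball_normE.
  by rewrite /= prod_normE gt_max -ball_normE => /andP[].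
have c2 : cvg (z.2 @[z --> F]).
  apply: cauchy_cvg; apply/cauchyP => e /Fc[z ze]; exists z.2.
  change (F [set y : E * E | ball z.2 e y.2]).
  apply: filterS ze => y zy;
    have {zy} : ball_ Num.norm z e y by rewrite ball_normE.
  by rewrite /= prod_normE gt_max -ball_normE => /andP[].
apply/cvg_ex; exists (lim (z.1 @[z --> F]), lim (z.2 @[z --> F])).
by apply/cvg_prodP.
Qed.

End Products.

Section Rotations.
Context (R : realType) (E : completeNormedModType R).
Implicit Types (a b s t h : R) (z u : E * E).

(** Multiplication by e^((a + ib) h) on pairs (x, y) standing for x + iy. *)
Definition rotation a b h z : E * E :=
  ((expR (a * h) * cos (b * h)) *: z.1 - (expR (a * h) * sin (b * h)) *: z.2,
   (expR (a * h) * cos (b * h)) *: z.2 + (expR (a * h) * sin (b * h)) *: z.1).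

(** Product rule: differentiate the factors p and f, while q vanishes at 0, so
   that only the value of g there enters. *)
Lemma combination_generator (p q : R -> R) (f g : R -> E) (x x' y : E)
    (a b : R) :
  h^-1 * (p h - 1) @[h --> (0 : R)^'+] --> a ->
  h^-1 * q h @[h --> (0 : R)^'+] --> b ->
  h^-1 *: (f h - x) @[h --> (0 : R)^'+] --> x' ->
  g h @[h --> (0 : R)^'+] --> y ->
  h^-1 *: (p h *: f h + q h *: g h - x) @[h --> (0 : R)^'+] -->
    x' + (a *: x + b *: y).
Proof.
move=> pa qb fx gy.
have p1 := right_continuous_of_derivative pa.
have : p h *: (h^-1 *: (f h - x)) +
    ((h^-1 * (p h - 1)) *: x + (h^-1 * q h) *: g h) @[h --> (0 : R)^'+] -->
    1 *: x' + (a *: x + b *: y).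
  by apply: cvgD; [exact: cvgZ|apply: cvgD; [exact: cvgZr_tmp|exact: cvgZ]].
rewrite scale1r; apply: cvg_trans; apply: near_eq_cvg; near=> h => /=.
rewrite -!scalerA [p h *: _]scalerA mulrC -scalerA -!scalerDr; congr (_ *: _).
by rewrite scalerBr scalerBl scale1r !addrA subrK addrAC.
Unshelve. all: by end_near. Qed.

Lemma rotation_generator a b (F : R -> E * E -> E * E) z u :
  F h z @[h --> 0^'+] --> z -> has_generator F z u ->
  has_generator (fun h y => rotation a b h (F h y)) z
    (u + (a *: z.1 - b *: z.2, a *: z.2 + b *: z.1)).
Proof.
move=> /cvg_prodP[Fz1 Fz2] /cvg_prodP[/= Fu1 Fu2].
have dc := @expcos_right_derivative R a b.
have ds := @expsin_right_derivative R a b.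
have dsN : h^-1 * - (expR (a * h) * sin (b * h)) @[h --> 0^'+] --> - b.
  by under eq_fun do rewrite mulrN; exact: cvgN.
apply/cvg_prodP; split => /=; last exact: combination_generator.
rewrite -scaleNr; under eq_fun do rewrite -scaleNr.
exact: combination_generator.
Qed.

Lemma rotation_cvg a b (F : R -> E * E) z :
  F h @[h --> 0^'+] --> z -> rotation a b h (F h) @[h --> 0^'+] --> z.
Proof.
move=> /cvg_prodP[Fz1 Fz2].
have c1 := right_continuous_of_derivative (@expcos_right_derivative R a b).
have s0 : expR (a * h) * sin (b * h) @[h --> 0^'+] --> 0.
  apply: (right_continuous_of_derivative (d := b)).
  by under eq_fun do rewrite subr0; exact: expsin_right_derivative.
apply/cvg_prodP; split => /=.
  rewrite -[z.1]subr0 -[X in X - _]scale1r -(scale0r z.2).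
  by apply: cvgB; exact: cvgZ.
rewrite -[z.2]addr0 -[X in X + _]scale1r -(scale0r z.1).
by apply: cvgD; exact: cvgZ.
Qed.

Lemma rotation0 a b z : rotation a b 0 z = z.
Proof.
rewrite /rotation !mulr0 expR0 cos0 sin0 mulr1 mulr0 !scale1r !scale0r.
by rewrite subr0 addr0; case: z.
Qed.

Lemma rotationD a a' b b' s t z :
  rotation a b s (rotation a' b' t z) =
  (expR (a * s + a' * t) * cos (b * s + b' * t) *: z.1 -
   expR (a * s + a' * t) * sin (b * s + b' * t) *: z.2,
   expR (a * s + a' * t) * cos (b * s + b' * t) *: z.2 +
   expR (a * s + a' * t) * sin (b * s + b' * t) *: z.1).
Proof.
rewrite /rotation /= expRD cosD sinD.
set e := expR (a * s); set c := cos (b * s); set d := sin (b * s).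
set e' := expR _; set c' := cos _; set d' := sin _.
have Ec : e * e' * (c * c' - d * d') =
    (e * c) * (e' * c') - (e * d) * (e' * d').
  by ring.
have Es : e * e' * (d * c' + c * d') =
    (e * d) * (e' * c') + (e * c) * (e' * d').
  by ring.
rewrite Ec Es; congr pair;
  rewrite !scalerDr !scalerN !scalerDl !scaleNr !scalerA.
  rewrite !opprD -!addrA; congr (_ + _).
  by rewrite addrC -addrA addrCA; congr (_ + _); rewrite addrC.
rewrite -!addrA; congr (_ + _).
by rewrite addrC -addrA addrCA.
Qed.

Lemma rotationDt a b s t z :
  rotation a b (s + t) z = rotation a b s (rotation a b t z).
Proof. by rewrite rotationD -!mulrDr. Qed.

Lemma rotationK a b h z : rotation a b h (rotation (- a) (- b) h z) = z.
Proof.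
rewrite rotationD !mulNr !subrr expR0 cos0 sin0 mulr1 mulr0 !scale1r !scale0r.
by rewrite subr0 addr0; case: z.
Qed.

Lemma rotation_linear a b h : linear (rotation a b h).
Proof.
move=> c z u; rewrite /rotation /=; set p := _ * _; set q := _ * _.
congr pair => /=;
  rewrite !scalerDr !scalerA ?scalerN ?scalerA (mulrC p) (mulrC q).
  by rewrite opprD addrACA.
by rewrite addrACA.
Qed.

Lemma rotation_norm a b h z : `|rotation a b h z| <= 2 * expR (a * h) * `|z|.
Proof.
rewrite /rotation prod_normE /=.
have z1 : `|z.1| <= `|z| by rewrite prod_normE le_max lexx.
have z2 : `|z.2| <= `|z| by rewrite prod_normE le_max lexx orbT.
have cle (y : E) : `|y| <= `|z| ->
  `|(expR (a * h) * cos (b * h)) *: y| <= expR (a * h) * `|z|.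
  move=> yz; rewrite normrZ normrM (ger0_norm (expR_ge0 _)) -mulrA.
  rewrite ler_wpM2l ?expR_ge0//; apply: le_trans yz.
  by rewrite ler_piMl// ler_norml cos_geN1 cos_le1.
have sle (y : E) : `|y| <= `|z| ->
  `|(expR (a * h) * sin (b * h)) *: y| <= expR (a * h) * `|z|.
  move=> yz; rewrite normrZ normrM (ger0_norm (expR_ge0 _)) -mulrA.
  rewrite ler_wpM2l ?expR_ge0//; apply: le_trans yz.
  by rewrite ler_piMl// ler_norml sin_geN1 sin_le1.
rewrite -mulrA mulr_natl mulr2n ge_max; apply/andP; split.
  by rewrite (le_trans (ler_normB _ _))// lerD ?cle ?sle.
by rewrite (le_trans (ler_normD _ _))// lerD ?cle ?sle.
Qed.

End Rotations.

Section Right_half_plane.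
Context (R : realType) (E : completeNormedModType R) (T : R -> E -> E).
Hypothesis ssgT : C0_semigroup T.
Context (w M : R).
Hypothesis Tbound : forall (t : R) (x : E), 0 <= t ->
  `|expR (- w * t) *: T t x| <= M * `|x|.

Definition double_semigroup (t : R) (z : E * E) : E * E := (T t z.1, T t z.2).
Local Notation TT := double_semigroup.

(** For l = a + ib, this semigroup is e^(- l t) T t on the complexification;
   the factor 2 pays for the max norm, which is not invariant under rotation. *)
Lemma rotated_semigroup_stable a b : w < a ->
  stable_semigroup (fun t z => rotation (- a) (- b) t (TT t z))
    (2 * (`|M| + 1)) (a - w).
Proof.
case: ssgT => Tlin T0 TD Tcvg wa; split.
- move=> t t0 c z u; rewrite -rotation_linear; congr rotation.
  by have [lt _] := Tlin t t0; rewrite /TT /= !lt.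
- by move=> z; rewrite /TT !T0 rotation0; case: z.
- move=> s t z s0 t0; rewrite rotationDt; congr rotation.
  have [ls _] := Tlin s s0.
  have lsB c d (x y : E) : T s (c *: x + d *: y) = c *: T s x + d *: T s y.
    rewrite ls; congr (_ + _).
    have ls0 : T s 0 = 0.
      by have := ls (- 1) 0 0; rewrite scaleN1r addNr => /= ->;
        rewrite scaleN1r addNr.
    by rewrite -[d *: y]addr0 ls ls0 addr0.
  by rewrite /rotation /TT /= !TD// -!scaleNr !lsB.
- move=> z.
  have TTz : TT t z @[t --> 0^'+] --> z by apply/cvg_prodP; split; exact: Tcvg.
  exact: rotation_cvg.
- move=> t z t0; apply: le_trans (rotation_norm _ _ _ _) _.
  have Tw x : `|T t x| <= expR (w * t) * ((`|M| + 1) * `|x|).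
    have := Tbound x t0; rewrite normrZ (ger0_norm (expR_ge0 _)) mulNr expRN.
    rewrite ler_pdivrMl ?expR_gt0// => /le_trans; apply.
    rewrite ler_wpM2l ?expR_ge0// ler_wpM2r//.
    by rewrite (le_trans (ler_norm M))// lerDl.
  rewrite (_ : expR (- ((a - w) * t)) = expR (- a * t) * expR (w * t));
    last first.
    by rewrite -expRD; congr expR; ring.
  rewrite [leRHS](_ : _ = 2 * expR (- a * t) *
    (expR (w * t) * ((`|M| + 1) * `|z|))); last by ring.
  rewrite ler_wpM2l ?mulr_ge0 ?expR_ge0// prod_normE ge_max.
  rewrite !(le_trans (Tw _))// ler_wpM2l ?expR_ge0// ler_wpM2l ?addr_ge0//.
    by rewrite prod_normE le_max lexx orbT.
  by rewrite prod_normE le_max lexx.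
Qed.

Lemma has_generatorP x y : has_generator T x y <->
  op_dom (generator idfun T) x /\ generator idfun T x = y.
Proof.
split=> [xy|[xd <-]]; last exact: xd.
by split; [exact: cvgP xy|exact: cvg_lim].
Qed.

(** The Laplace transform of T at l is the resolvent of the generator at l:
   it is [laplace] of the rotated semigroup, whose generator is that of T
   minus l; undoing the rotation recovers the generator of T. *)
Lemma resolvent_right_half_plane (l : R[i]) : w < complex.Re l ->
  resolvent_set (complexify_op (generator idfun T)) l.
Proof.
case: l => a b /= wa.
have Q := rotated_semigroup_stable b wa.
have M0 : 0 < 2 * (`|M| + 1) by rewrite mulr_gt0// ltr_pwDr.
have aw0 : 0 < a - w by rewrite subr_gt0.
have hQ z u : has_generator TT z u ->
  has_generator (fun t y => rotation (- a) (- b) t (TT t y)) z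
   (u + (- a *: z.1 - - b *: z.2, - a *: z.2 + - b *: z.1)).
  apply: rotation_generator.
  by apply/cvg_prodP; case: ssgT => _ _ _ Tcvg; split; exact: Tcvg.
pose S := laplace (fun t y => rotation (- a) (- b) t (TT t y)).
have SQ f : has_generator TT (S f) (- f + (a *: (S f).1 - b *: (S f).2,
  a *: (S f).2 + b *: (S f).1)).
  have := laplace_has_generator (@prod_complete _ E) M0 aw0 Q (f := f).
  move=> /(rotation_generator (a := a) (b := b) (stable_cvg Q (x := S f))).
  rewrite /has_generator; under eq_fun do rewrite !rotationK.
  by [].
have TTP z u : has_generator TT z u <-> has_generator T z.1 u.1 /\
  has_generator T z.2 u.2.
  split; first by move=> /cvg_prodP.
  by move=> H; apply/cvg_prodP.
exists S; split.
- have Sc : continuous (S : E * E -> E * E).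
    move=> f; apply: (cvg_norm_le (r :=
      fun g => riemann_constant (2 * (`|M| + 1)) (a - w) * `|g - f|)).
      near=> g; rewrite -(laplaceB (@prod_complete _ E) M0 aw0 Q).
      exact: (laplace_norm (@prod_complete _ E) M0 aw0 Q).
    rewrite -(mulr0 (riemann_constant (2 * (`|M| + 1)) (a - w))).
    apply: cvgMr; apply/norm_cvg0P; rewrite -(subrr f).
    by apply: cvgB; [exact: cvg_id|exact: cvg_cst].
  exact: Sc.
- move=> f; have /TTP[/has_generatorP[d1 e1] /has_generatorP[d2 e2]] := SQ f.
  split; first by split.
  transitivity ((a *: (S f).1 - b *: (S f).2 - generator idfun T (S f).1,
                 a *: (S f).2 + b *: (S f).1 - generator idfun T (S f).2)
    : E * E).
    by [].
  have cancel_fst (x y : E) : x - (- y + x) = y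
    by rewrite opprD opprK addrCA subrr addr0.
  rewrite e1 e2; transitivity ((f.1, f.2) : E * E); last by case: (f).
  by congr pair; exact: cancel_fst.
- move=> x [d1 d2].
  have /hQ := (TTP x (generator idfun T x.1,
    generator idfun T x.2)).2 (conj d1 d2).
  move=> /(laplace_generator (@prod_complete _ E) M0 aw0 Q).
  set u := _ + _ => Su.
  have SB f g : S (f - g) = S f - S g
    by exact: (laplaceB (@prod_complete _ E) M0 aw0 Q).
  have S0 : S 0 = 0 by rewrite -[X in S X](subrr (0 : E * E)) SB subrr.
  have -> : (a +i* b) *: x - complexify_op (generator idfun T) x = - u.
    transitivity ((a *: x.1 - b *: x.2 - generator idfun T x.1,
                   a *: x.2 + b *: x.1 - generator idfun T x.2) : E * E).
      by [].
    by congr pair; rewrite /= !scaleNr !opprD ?opprK addrC.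
  by rewrite -sub0r SB S0 sub0r -[S u]/(laplace _ u) Su opprK.
Unshelve. all: by end_near. Qed.

End Right_half_plane.

(** * Exponential growth of a semigroup *)

Section Exponential_bound.
Context (R : realType) (E : completeNormedModType R).

Lemma continuous_linear_bound (f : E -> E) : linear f -> continuous f ->
  exists2 M : R, 0 < M & forall x, `|f x| <= M * `|x|.
Proof.
move=> lf cf.
pose g : {linear E -> E} := HB.pack f (GRing.isLinear.Build _ _ _ _ _ lf).
have /linear_boundedP gb :=
  continuous_linear_bounded (0 : E) (cf 0 : {for 0, continuous g}).
near (+oo : set_system R) => M.
exists M; first by near: M; exact: nbhs_pinfty_gt.
by near: M; exact: gb.
Unshelve. all: by end_near. Qed.

Lemma linear_unit_ball_bound (f : E -> E) (M : R) : linear f ->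
  (forall x, `|x| <= 1 -> `|f x| <= M) -> forall x, `|f x| <= M * `|x|.
Proof.
move=> lf fM x.
pose g : {linear E -> E} := HB.pack f (GRing.isLinear.Build _ _ _ _ _ lf).
have [->|x0] := eqVneq x 0;
  first by rewrite -[f]/(g : E -> E) linear0 !normr0 mulr0.
have x0' : 0 < `|x| by rewrite normr_gt0.
have : `|g (`|x|^-1 *: x)| <= M.
  by apply: fM; rewrite normrZ normfV normr_id mulVf// gt_eqF.
by rewrite linearZ/= normrZ normfV normr_id ler_pdivrMl// mulrC.
Qed.

Context (T : R -> E -> E).
Hypothesis ssgT : C0_semigroup T.

(** Otherwise there are times t n -> 0 at which the norm of T exceeds n, while
   T (t n) x -> x stays bounded for each x, against Banach-Steinhaus. *)
Lemma bounded_near0 : exists z M : R, [/\ 0 < z, 1 <= M &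
  forall t x, 0 <= t < z -> `|T t x| <= M * `|x|].
Proof.
case: ssgT => Tlin T0 TD Tcvg; apply: contrapT => /forallNP unbounded.
have /choice[t /choice[v tv]] n : exists t x,
  0 <= t < n.+1%:R^-1 /\ n.+1%:R * `|x| < `|T t x|.
  apply: contrapT => none;
    have /forallNP/(_ n.+1%:R) := unbounded (n.+1%:R^-1 : R).
  apply; split; [by rewrite invr_gt0 ltr0n|by rewrite ler1n|].
  move=> t x tn; rewrite leNgt; apply/negP => lt; apply: none.
  by exists t, x.
have t_ge0 n : 0 <= t n by have [/andP[]] := tv n.
have Tfam : uniform_bounded (range (fun n => T (t n)));
  first apply: Banach_Steinhauss.
- move=> _ [n _ <-]; have [ln cn] := Tlin _ (t_ge0 n); split => // r.
  have [M M0 HM] := continuous_linear_bound ln cn.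
  exists (M * r) => x xr; apply: le_trans (HM x) _.
  by rewrite ler_wpM2l// ltW.
- move=> x; have /cvgrPdist_le/(_ _ ltr01)[z /= z0 Hz] := Tcvg x.
  pose N := Num.trunc z^-1.
  exists (1 + `|x| + \sum_(n < N.+1) `|T (t n) x|) => _ [n _ <-].
  have s0 : 0 <= \sum_(n < N.+1) `|T (t n) x| by exact: sumr_ge0.
  have [nN|Nn] := ltnP n N.+1.
    rewrite (bigD1 (Ordinal nN))//= addrCA lerDl.
    by rewrite addr_ge0 ?addr_ge0// sumr_ge0.
  have xT : `|x - T (t n) x| <= 1.
    have [tn0|tn0] := eqVneq (t n) 0; first by rewrite tn0 T0 subrr normr0.
    apply: Hz => /=; last by rewrite lt_def tn0 t_ge0.
    rewrite sub0r normrN ger0_norm//; have [/andP[_ tn1] _] := tv n.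
    apply: lt_le_trans tn1 _; rewrite -[leRHS]invrK lef_pV2 ?posrE ?invr_gt0//.
    have zi : 0 <= z^-1 by rewrite invr_ge0 ltW.
    have /andP[_ /ltW/le_trans] := trunc_itv zi.
    by apply; rewrite ler_nat ltnW.
  rewrite -[T _ x](subKr x); apply: le_trans (ler_normB _ _) _.
  by have := normr_ge0 x; lra.
have [M HM] := Tfam 1.
pose n := Num.trunc `|M|; have [_] := tv n.
apply/negP; rewrite -leNgt; have [ln _] := Tlin _ (t_ge0 n).
apply: le_trans (linear_unit_ball_bound ln (HM _ _) (v n)) _; first by exists n.
rewrite ler_wpM2r//; have /andP[_ /ltW] := @trunc_itv R `|M| (normr_ge0 M).
exact: le_trans (ler_norm M).
Qed.

(** Any t is a multiple of a fixed short time d plus a remainder below d, so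
   the norm grows at most by a fixed factor per time d. *)
Lemma exponential_bound : exists w M : R, 0 < M /\
  forall t x, 0 <= t -> `|T t x| <= M * expR (w * t) * `|x|.
Proof.
have [z [M [z0 M1 TM]]] := bounded_near0.
have M0 : 0 < M by apply: lt_le_trans M1.
case: ssgT => Tlin T0 TD Tcvg.
pose d := z / 2; have d0 : 0 < d by rewrite divr_gt0.
have dz : d < z by rewrite /d; lra.
have kd0 n : 0 <= n%:R * d by apply: mulr_ge0 => //; exact: ltW.
have Tn n x : `|T (n%:R * d) x| <= M ^+ n * `|x|.
  elim: n x => [|n IH] x; first by rewrite mul0r T0 expr0 mul1r.
  rewrite -natr1 mulrDl mul1r addrC TD ?kd0 ?(ltW d0)//.
  apply: le_trans (TM _ _ _) _; first by rewrite (ltW d0) dz.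
  by rewrite exprS -mulrA ler_wpM2l ?(ltW M0).
exists (ln M / d), M; split => // t x t0.
have td0 : 0 <= t / d by rewrite divr_ge0// ltW.
have /andP[nt tn] := trunc_itv td0.
set n := Num.trunc _ in nt tn.
have nd : n%:R * d <= t by rewrite -ler_pdivlMr.
have td : t - n%:R * d < d.
  by rewrite ltrBlDr; move: tn; rewrite -natr1 ltr_pdivrMr// mulrDl mul1r addrC.
rewrite -(subrK (n%:R * d) t) TD ?subr_ge0 ?kd0//.
apply: le_trans (TM _ _ _) _; first by rewrite subr_ge0 nd (lt_trans td).
rewrite -mulrA ler_wpM2l ?(ltW M0)//; apply: le_trans (Tn _ _) _.
rewrite ler_wpM2r// subrK -[M in M ^+ n]lnK ?posrE// -expRM_natl ler_expR.
rewrite mulrC -mulrA ler_wpM2l ?ln_ge0//.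
by rewrite mulrC.
Qed.

End Exponential_bound.

(** * Order and norm in a Banach lattice *)

Reserved Notation "x ⊑ y" (at level 70, no associativity).
Local Notation "x ⊑ y" := (blat_le x y).

Section Lattice.
Context (R : realType) (E : banachLatticeType R).
Implicit Types (x y z f g : E).

Lemma blat_subr_ge0 x y : 0 ⊑ y - x <-> x ⊑ y.
Proof.
split=> [/(@blat_leD2r _ _ _ _ x)|/(@blat_leD2r _ _ _ _ (- x))].
  by rewrite add0r subrK.
by rewrite subrr.
Qed.

(** [blat_le_trans] with the endpoints left to unification. *)
Lemma blat_le_trans_at y x z : x ⊑ y -> y ⊑ z -> x ⊑ z.
Proof. exact: blat_le_trans. Qed.

Lemma blat_leD x y z t : x ⊑ y -> z ⊑ t -> x + z ⊑ y + t.
Proof.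
move=> xy zt; apply: blat_le_trans_at (blat_leD2r _ _ z xy) _.
by rewrite ![y + _]addrC; exact: blat_leD2r.
Qed.

Lemma blat_addr_ge0 x y : 0 ⊑ x -> 0 ⊑ y -> 0 ⊑ x + y.
Proof. by move=> x0 y0; rewrite -[0 in X in X ⊑ _]addr0; exact: blat_leD. Qed.

Lemma blat_leN x y : x ⊑ y -> - y ⊑ - x.
Proof.
by move=> /blat_subr_ge0 xy; apply/blat_subr_ge0; rewrite opprK addrC.
Qed.

Lemma blat_sum_ge0 n (F : 'I_n -> E) : (forall i, 0 ⊑ F i) ->
  0 ⊑ \sum_(i < n) F i.
Proof.
move=> F0; elim/big_ind: _ => //; first exact: blat_le_refl.
exact: blat_addr_ge0.
Qed.

Definition blat_abs x := blat_sup x (- x).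

Lemma blat_abs_ge0 x : 0 ⊑ blat_abs x.
Proof.
have : 0 ⊑ (2^-1 : R) *: (blat_abs x + blat_abs x).
  apply: blat_scale_ge0; first by rewrite invr_ge0.
  rewrite -(subrr x); apply: blat_leD; first exact: blat_le_supl.
  exact: blat_le_supr.
have half : 2^-1 * (1 + 1) = 1 :> R by field.
by rewrite -{1 2}[blat_abs x]scale1r -scalerDl scalerA half scale1r.
Qed.

Lemma blat_abs_id x : 0 ⊑ x -> blat_abs x = x.
Proof.
move=> x0; apply: blat_le_anti; last exact: blat_le_supl.
apply: blat_sup_le; first exact: blat_le_refl.
by have := blat_leN x0; rewrite oppr0 => /blat_le_trans_at; exact.
Qed.

Lemma norm_blat_abs x : `|blat_abs x| = `|x|.
Proof.
have e : blat_abs (blat_abs x) = blat_abs x := blat_abs_id (blat_abs_ge0 x).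
apply/le_anti/andP; split; apply: blat_le_norm;
  rewrite -/(blat_abs (blat_abs x)) e; exact: blat_le_refl.
Qed.

Lemma blat_norm_mono x y : 0 ⊑ x -> x ⊑ y -> `|x| <= `|y|.
Proof.
move=> x0 xy; have y0 := blat_le_trans_at x0 xy.
by apply: blat_le_norm; rewrite -/(blat_abs x) -/(blat_abs y) !blat_abs_id.
Qed.

Definition blat_pos x := blat_sup x 0.

Lemma blat_pos_ge0 x : 0 ⊑ blat_pos x.
Proof. exact: blat_le_supr. Qed.

Lemma blat_posB x : x = blat_pos x - blat_pos (- x).
Proof.
suff {1}-> : blat_pos x = blat_pos (- x) + x by rewrite addrC addKr.
apply: blat_le_anti.
  apply: blat_sup_le; apply/blat_subr_ge0; first by rewrite addrK;
    exact: blat_pos_ge0.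
  rewrite subr0 addrC -[x in x + _]opprK addrC; apply/blat_subr_ge0.
  exact: blat_le_supl.
rewrite -[X in _ ⊑ X](subrK x); apply: blat_leD2r.
apply: blat_sup_le; apply/blat_subr_ge0.
  by rewrite opprK subrK; exact: blat_pos_ge0.
exact: blat_le_supl.
Qed.

Lemma blat_pos_le_abs x : blat_pos x ⊑ blat_abs x.
Proof. by apply: blat_sup_le; [exact: blat_le_supl|exact: blat_abs_ge0]. Qed.

Lemma norm_blat_pos x : `|blat_pos x| <= `|x|.
Proof.
rewrite -[leRHS]norm_blat_abs.
by apply: blat_norm_mono; [exact: blat_pos_ge0|exact: blat_pos_le_abs].
Qed.

(** The positive cone is closed: the negative part of x is at most |r|. *)
Lemma blat_ge0_approx x :
  (forall e : R, 0 < e -> exists2 r : E, `|r| <= e & 0 ⊑ x + r) -> 0 ⊑ x.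
Proof.
move=> approx; have : `|blat_pos (- x)| <= 0.
  apply/ler_addgt0Pl => e e0; rewrite addr0; have [r re xr] := approx e e0.
  apply: le_trans re; rewrite -[leRHS]norm_blat_abs.
  apply: blat_norm_mono (blat_pos_ge0 _) _.
  apply: blat_sup_le (blat_abs_ge0 _).
  apply: blat_le_trans_at (blat_le_supl _ _).
  by apply/blat_subr_ge0; rewrite opprK addrC.
rewrite normr_le0 => /eqP x0; have := blat_le_supl (- x) 0.
by rewrite -/(blat_pos _) x0 => /blat_leN; rewrite oppr0 opprK.
Qed.

Lemma blat_ge0_lim (U : Type) (F : set_system U) {FF : ProperFilter F}
    (f : U -> E) x :
  f k @[k --> F] --> x -> (\forall k \near F, 0 ⊑ f k) -> 0 ⊑ x.
Proof.
move=> /cvgrPdist_le fx f0; apply: blat_ge0_approx => e e0; near F => k.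
exists (f k - x); last by rewrite addrC subrK; near: k.
by rewrite distrC; near: k; exact: fx.
Unshelve. all: by end_near. Qed.

(** The supremum of 0 and of the first n values of v. *)
Fixpoint blat_sups (v : nat -> E) n : E :=
  if n is n.+1 then blat_sup (blat_sups v n) (v n) else 0.

Lemma blat_sups_ge0 v n : 0 ⊑ blat_sups v n.
Proof.
elim: n => [|n IH] /=; first exact: blat_le_refl.
by apply: blat_le_trans_at IH _; exact: blat_le_supl.
Qed.

Lemma blat_le_sups v n i : (i < n)%N -> v i ⊑ blat_sups v n.
Proof.
elim: n => // n IH; rewrite ltnS leq_eqVlt => /predU1P[->|/IH vi] /=.
  exact: blat_le_supr.
by apply: blat_le_trans_at vi _; exact: blat_le_supl.
Qed.

Lemma norm_blat_sups v n (c : R) : AM_space E -> 0 <= c ->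
  (forall i, (i < n)%N -> 0 ⊑ v i /\ `|v i| <= c) -> `|blat_sups v n| <= c.
Proof.
move=> AM c0; elim: n => [|n IH] vc /=; first by rewrite normr0.
have [v0 vn] := vc n (ltnSn n).
rewrite AM//; last exact: blat_sups_ge0.
rewrite ge_max vn andbT; apply: IH => i /ltnW; exact: vc.
Qed.

(** |x| - c x is a convex combination of |x| - x and |x| + x. *)
Lemma blat_scale_le_abs (c : R) x : -1 <= c <= 1 -> c *: x ⊑ blat_abs x.
Proof.
move=> /andP[c1 c2]; apply/blat_subr_ge0.
set p := (1 + c) / 2; set q := (1 - c) / 2.
have pq : p + q = 1 by rewrite /p /q; field.
have cE : c = p - q by rewrite /p /q; field.
have abs0 : blat_abs x - c *: x = p *: (blat_abs x - x) + q *: (blat_abs x + x).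
  rewrite -{1}[blat_abs x]scale1r -pq cE scalerBl scalerDl scalerBr scalerDr.
  by rewrite opprB [RHS]addrACA; congr (_ + _); exact: addrC.
rewrite abs0; apply: blat_addr_ge0; apply: blat_scale_ge0.
- by rewrite divr_ge0//; lra.
- by apply/blat_subr_ge0; exact: blat_le_supl.
- by rewrite divr_ge0//; lra.
- by rewrite -[x in _ + x]opprK; apply/blat_subr_ge0; exact: blat_le_supr.
Qed.

(** The angles 0, pi, pi / 2 and - pi / 2 in the definition of the modulus. *)
Lemma abs_le_modulus x y m : is_modulus x y m ->
  blat_abs x ⊑ m /\ blat_abs y ⊑ m.
Proof.
move=> [mu _]; split; apply: blat_sup_le.
- by have := mu 0; rewrite cos0 sin0 scale1r scale0r addr0.
- by have := mu pi; rewrite cospi sinpi scaleN1r scale0r addr0.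
- by have := mu (pi / 2); rewrite cos_pihalf sin_pihalf scale1r scale0r add0r.
- have := mu (- (pi / 2)); rewrite cosN sinN cos_pihalf sin_pihalf.
  by rewrite scaleN1r scale0r add0r.
Qed.

End Lattice.

(** * Rescaled semigroups and real resolvents *)

Section Generator.
Context (R : realType) (E : completeNormedModType R).
Implicit Types (T : R -> E -> E) (x y : E) (S : E -> E).

(** Multiplication by e^(a t) shifts the generator by a. *)
Definition rescale T (a : R) : R -> E -> E := fun t x => expR (a * t) *: T t x.

Lemma rescaleK T a : rescale (rescale T a) (- a) = T.
Proof.
apply/funext => t; apply/funext => x;
  rewrite /rescale scalerA -expRD mulNr addNr.
by rewrite expR0 scale1r.
Qed.

Lemma rescale_generator T a x y : T h x @[h --> (0 : R)^'+] --> x ->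
  has_generator T x y -> has_generator (rescale T a) x (y + a *: x).
Proof.
move=> Tx xy.
have q0 : h^-1 * 0 @[h --> (0 : R)^'+] --> (0 : R).
  by under eq_fun do rewrite mulr0; exact: cvg_cst.
have := combination_generator (@exp_right_derivative R a) q0 xy Tx.
rewrite scale0r addr0 /has_generator /rescale.
by under eq_fun do rewrite scale0r addr0.
Qed.

Lemma rescale_C0 T a : C0_semigroup T -> C0_semigroup (rescale T a).
Proof.
move=> [Tlin T0 TD Tcvg]; split.
- move=> t t0; have [lt ct] := Tlin t t0; split.
    by move=> c x y; rewrite /rescale lt scalerDr !scalerA mulrC.
  by move=> x; apply: cvgZl_tmp; exact: ct.
- by move=> x; rewrite /rescale mulr0 expR0 scale1r T0.
- move=> s t x s0 t0; rewrite /rescale TD// mulrDr expRD.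
  have [ls _] := Tlin s s0.
  have TsZ c y : T s (c *: y) = c *: T s y.
    have TC0 : T s 0 = 0 by have := ls (- 1) 0 0; rewrite scaler0 addr0 => ->;
      rewrite scaleN1r addNr.
    by have := ls c y 0; rewrite !addr0 TC0 addr0.
  by rewrite TsZ scalerA.
- move=> x; rewrite -[X in _ --> X]scale1r; apply: cvgZ => //.
  exact: right_continuous_of_derivative (@exp_right_derivative R a).
Qed.

Definition real_resolvent T (l : R) S : Prop :=
  [/\ forall f, has_generator T (S f) (l *: S f - f),
      forall x y, has_generator T x y -> S (l *: x - y) = x &
      exists2 C, 0 < C & forall f, `|S f| <= C * `|f|].

Lemma has_generator_linear T c x y x' y' : C0_semigroup T ->
  has_generator T x y -> has_generator T x' y' ->
  has_generator T (c *: x + x') (c *: y + y').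
Proof.
move=> [Tlin _ _ _] xy xy'.
have : c *: (h^-1 *: (T h x - x)) + h^-1 *: (T h x' - x') @[h --> (0 : R)^'+]
  --> c *: y + y'.
  by apply: cvgD => //; exact: cvgZl_tmp.
apply: cvg_trans; apply: near_eq_cvg; near=> h => /=.
have h0 : 0 < h by [].
have [lh _] := Tlin h (ltW h0).
rewrite lh scalerA mulrC -scalerA -scalerDr; congr (_ *: _).
by rewrite scalerBr opprD addrACA.
Unshelve. all: by end_near. Qed.

(** The inverse of a linear relation is linear. *)
Lemma generator_inverse_linear T l S : C0_semigroup T ->
  (forall f, has_generator T (S f) (l *: S f - f)) ->
  (forall x y, has_generator T x y -> S (l *: x - y) = x) -> linear S.
Proof.
move=> ssgT ST SK c f g.
have := SK _ _ (has_generator_linear (c := c) ssgT (ST f) (ST g)).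
rewrite scalerDr !scalerBr !scalerA (mulrC c) !opprD !opprK addrACA.
by rewrite !addNKr.
Qed.

Lemma real_resolvent_linear T l S : C0_semigroup T -> real_resolvent T l S ->
  linear S.
Proof. by move=> ssgT [ST SK _]; exact: generator_inverse_linear ST SK. Qed.

Lemma rescale_resolvent T a l S : C0_semigroup T ->
  real_resolvent T l S -> real_resolvent (rescale T a) (l + a) S.
Proof.
move=> ssgT [ST SK Sb]; have [_ _ _ Tcvg] := ssgT; split => //.
  move=> f; rewrite scalerDl addrAC.
  exact: rescale_generator.
move=> x y xy; have [_ _ _ rcvg] := rescale_C0 a ssgT.
have := rescale_generator (a := - a) (rcvg x) xy.
rewrite rescaleK => /SK Sx; rewrite -[RHS]Sx; congr S.
by rewrite scalerDl scaleNr opprD opprK addrA addrAC.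
Qed.

End Generator.

(** * Positivity of the resolvent *)

Section Positive_resolvent.
Context (R : realType) (E : banachLatticeType R) (T : R -> E -> E).
Hypothesis ssgT : C0_semigroup T.
Hypothesis Tpos : positive_semigroup [set f : E | 0 ⊑ f] T.
Implicit Types (f g x y : E) (S : E -> E) (l m t : R).

Definition positive_op S := forall f, 0 ⊑ f -> 0 ⊑ S f.

(** For large l the resolvent is a Laplace transform, hence a limit of Riemann
   sums of positive vectors. *)
Lemma resolvent_pos_large : exists w : R, forall l S, w < l ->
  real_resolvent T l S -> positive_op S.
Proof.
have [w [M [M0 TM]]] := exponential_bound ssgT.
exists w => l S wl [ST SK _] f f0.
have [_ _ _ Tcvg] := ssgT.
have [Tlin T0 TD rcvg] := rescale_C0 (- l) ssgT.
have ssgr : stable_semigroup (rescale T (- l)) M (l - w).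
  split => //; first by move=> t /Tlin[].
  move=> t x t0; rewrite /rescale normrZ (ger0_norm (expR_ge0 _)).
  apply: le_trans (ler_wpM2l (expR_ge0 _) (TM t x t0)) _.
  have -> : expR (- ((l - w) * t)) = expR (- l * t) * expR (w * t).
    by rewrite -expRD; congr expR; ring.
  by rewrite le_eqVlt; apply/orP; left; apply/eqP; ring.
have lw0 : 0 < l - w by rewrite subr_gt0.
have Ec : forall F : set_system E, ProperFilter F -> cauchy F -> cvg F
  by move=> F FF; exact: cauchy_cvg.
have := laplace_has_generator Ec M0 lw0 ssgr (f := f).
set x := laplace _ f => xf.
have := rescale_generator (a := l) (rcvg x) xf.
have rK := rescaleK T (- l); rewrite opprK in rK; rewrite rK => /SK.
rewrite opprD opprK addrCA subrr addr0 => ->.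
apply: blat_ge0_lim (laplace_lim Ec M0 lw0 ssgr (f := f)) _.
near=> h; have h0 : 0 < h by [].
apply: blat_scale_ge0; first exact: ltW.
apply: blat_sum_ge0 => i; apply: blat_scale_ge0; first exact: expR_ge0.
by apply: Tpos => //; rewrite mulr_ge0// ltW.
Unshelve. all: by end_near. Qed.

Lemma resolvent_identity l m Sl Sm f : real_resolvent T l Sl ->
  real_resolvent T m Sm -> Sl f = Sm (f + (m - l) *: Sl f).
Proof.
move=> [Sl1 _ _] [_ Sm2 _]; rewrite -{1}(Sm2 _ _ (Sl1 f)); congr Sm.
by rewrite opprB scalerBl addrCA.
Qed.

(** Sm f = Sl (f - (m - l) Sm f), and the second term is absorbed by the left
   hand side. *)
Lemma resolvent_norm_above l m Sl Sm C f : real_resolvent T l Sl ->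
  0 <= C -> (forall g, `|Sl g| <= C * `|g|) -> l <= m -> (m - l) * C <= 2^-1 ->
  real_resolvent T m Sm -> `|Sm f| <= 2 * C * `|f|.
Proof.
move=> rl C0 Cl lm mlC rm; have e := resolvent_identity f rm rl.
have : `|Sm f| <= C * (`|f| + (m - l) * `|Sm f|).
  rewrite {1}e; apply: le_trans (Cl _) _; rewrite ler_wpM2l//.
  apply: le_trans (ler_normD _ _) _.
  by rewrite normrZ distrC ger0_norm// subr_ge0.
have := ler_wpM2r (normr_ge0 (Sm f)) mlC; lra.
Qed.

(** For f >= 0 and x = Sl f the resolvent identity gives
   x = Sm f + (m - l) Sm x >= - (m - l) Sm x^-, so that
   x^- <= (m - l) Sm x^- and the norm of x^- is at most half of itself. *)
Lemma resolvent_pos_below l m Sl Sm C : real_resolvent T l Sl ->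
  real_resolvent T m Sm -> positive_op Sm ->
  (forall g, `|Sm g| <= C * `|g|) -> 0 <= m - l -> (m - l) * C <= 2^-1 ->
  positive_op Sl.
Proof.
move=> rl rm Sm0 Cm lm mlC f f0.
have Slin := real_resolvent_linear ssgT rm.
pose S : {linear E -> E} := HB.pack Sm (GRing.isLinear.Build _ _ _ _ _ Slin).
set x := Sl f.
have xE : x = S f + (m - l) *: S x.
  by rewrite -linearZ -linearD /=; exact: resolvent_identity.
have xn : blat_pos (- x) ⊑ (m - l) *: S (blat_pos (- x)).
  apply: blat_sup_le; last first.
    by apply: blat_scale_ge0 => //; apply: Sm0; exact: blat_pos_ge0.
  apply/blat_subr_ge0; rewrite opprK {2}xE {2}(blat_posB x) linearB scalerBr.
  rewrite addrC addrA subrK; apply: blat_addr_ge0; first exact: Sm0.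
  by apply: blat_scale_ge0 => //; apply: Sm0; exact: blat_pos_ge0.
have : `|blat_pos (- x)| <= 2^-1 * `|blat_pos (- x)|.
  apply: le_trans (blat_norm_mono (blat_pos_ge0 _) xn) _.
  rewrite normrZ ger0_norm//; apply: le_trans (ler_wpM2l lm (Cm _)) _.
  by rewrite mulrA ler_wpM2r.
move=> n2; have : `|blat_pos (- x)| <= 0 by lra.
rewrite normr_le0 => /eqP n0; rewrite (blat_posB x) n0 subr0;
  exact: blat_pos_ge0.
Qed.

(** Positivity descends from large l to w by an infimum argument: near the
   infimum l0 of the good parameters the resolvents are uniformly bounded by
   [resolvent_norm_above], so [resolvent_pos_below] makes a step below l0 of a
   length independent of the starting point. *)
Lemma resolvent_pos w : (forall l, w <= l -> exists S, real_resolvent T l S) ->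
  forall S, real_resolvent T w S -> positive_op S.
Proof.
move=> rS.
pose P l := forall S, real_resolvent T l S -> positive_op S.
pose G := [set l | w <= l /\ forall m, l <= m -> P m].
have [w0 w0P] := resolvent_pos_large.
have Gmax : G (Num.max w (w0 + 1)).
  split; first by rewrite le_max lexx.
  move=> m; rewrite ge_max => /andP[_ w0m] S; apply: w0P.
  by apply: lt_le_trans w0m; rewrite ltrDl.
have Gnon : has_inf G by split; [exists (Num.max w (w0 + 1))|exists w => l []].
pose l0 := inf G.
have wl0 : w <= l0 by apply: lb_le_inf => [|l []//];
  exists (Num.max w (w0 + 1)).
have [S0 rS0] := rS _ wl0.
have [_ _ [C C0 S0C]] := rS0.
(* The starting point m lies within d of l0 and its resolvent is bounded by
   2 C, so parameters down to l0 - d cost 2 d * 2 C = 1 / 2. *)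
pose d := (8 * C)^-1.
have d0 : 0 < d by rewrite invr_gt0 mulr_gt0.
have dC : d * C = 8^-1 by rewrite /d invfM mulfVK// gt_eqF.
have [m Gm ml0] := inf_adherent d0 Gnon.
have l0m : l0 <= m by apply: ge_inf => //; case: Gnon.
have [Sm rSm] : exists S, real_resolvent T m S by apply: rS; case: Gm.
have SmC f : `|Sm f| <= 2 * C * `|f|.
  apply: (resolvent_norm_above f rS0 (ltW C0) S0C l0m _ rSm).
  apply: le_trans (_ : d * C <= _); last by rewrite dC; lra.
  by rewrite ler_wpM2r ?(ltW C0)// lerBlDl ltW.
have Gnew : G (Num.max w (l0 - d)).
  split; first by rewrite le_max lexx.
  move=> l; rewrite ge_max => /andP[wl dl].
  have [ml|/ltW lm] := leP m l; first by case: Gm => _; apply.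
  move=> S rl; apply: (resolvent_pos_below rl rSm _ SmC).
  - by case: Gm => _ /(_ _ (lexx m)); exact.
  - by rewrite subr_ge0.
  - apply: le_trans (_ : 2 * d * (2 * C) <= _); last first.
      by rewrite mulrACA dC; lra.
    rewrite ler_wpM2r ?mulr_ge0 ?(ltW C0)//.
    have ml0' : m < l0 + d := ml0.
    lra.
have : l0 <= Num.max w (l0 - d) by apply: ge_inf => //; case: Gnon.
rewrite le_max => /orP[l0w|]; last by rewrite lerBrDr gerDl leNgt d0.
have [_] := Gnew.
by apply; rewrite ge_max lexx; apply: le_trans l0w; rewrite lerBlDr lerDl ltW.
Qed.

End Positive_resolvent.

(** * Boundedness on AM-spaces *)

Section Stability.
Context (R : realType) (E : banachLatticeType R) (T : R -> E -> E).
Hypothesis ssgT : C0_semigroup T.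
Hypothesis Tpos : positive_semigroup [set f : E | 0 ⊑ f] T.
Context (S : E -> E).
Hypotheses (rS : real_resolvent T 0 S) (S_pos : positive_op S).
Implicit Types (f g x y : E) (s t h : R) (n : nat).

Let SC : exists2 C, 0 < C & forall f, `|S f| <= C * `|f|.
Proof. by case: rS. Qed.

Let T0 x : T 0 x = x.
Proof. by case: ssgT. Qed.

Let TD s t x : 0 <= s -> 0 <= t -> T (s + t) x = T s (T t x).
Proof. by case: ssgT => _ _ TD _; exact: TD. Qed.

Let TC s t x : 0 <= s -> 0 <= t -> T s (T t x) = T t (T s x).
Proof. by move=> s0 t0; rewrite -!TD// addrC. Qed.

Let Tlin t : 0 <= t -> linear (T t).
Proof. by case: ssgT => Tl _ _ _ /Tl[]. Qed.

Let TB t x y : 0 <= t -> T t (x - y) = T t x - T t y.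
Proof.
move=> t0; pose g : {linear E -> E} :=
  HB.pack (T t) (GRing.isLinear.Build _ _ _ _ _ (Tlin t0)).
exact: (linearB g).
Qed.

Let TZ t c x : 0 <= t -> T t (c *: x) = c *: T t x.
Proof.
move=> t0; pose g : {linear E -> E} :=
  HB.pack (T t) (GRing.isLinear.Build _ _ _ _ _ (Tlin t0)).
by rewrite -[T t]/(g : E -> E) linearZ.
Qed.

Let Tmono t x y : 0 <= t -> x ⊑ y -> T t x ⊑ T t y.
Proof.
move=> t0 /blat_subr_ge0 xy; apply/blat_subr_ge0; rewrite -TB//; exact: Tpos.
Qed.

Lemma bounded_on_interval t : 0 <= t -> exists2 K : R, 0 < K &
  forall s x, 0 <= s <= t -> `|T s x| <= K * `|x|.
Proof.
move=> t0; have [w [M [M0 TM]]] := exponential_bound ssgT.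
exists (M * expR (`|w| * t)); first by rewrite mulr_gt0// expR_gt0.
move=> s x /andP[s0 st]; apply: le_trans (TM s x s0) _.
rewrite ler_wpM2r// ler_wpM2l ?(ltW M0)// ler_expR.
apply: le_trans (_ : `|w| * s <= _); first by rewrite ler_wpM2r// ler_norm.
by rewrite ler_wpM2l.
Qed.

Lemma telescope_sum h n x : 0 <= h ->
  \sum_(i < n) T (i%:R * h) (x - T h x) = x - T (n%:R * h) x.
Proof.
move=> h0; elim: n => [|n IH]; first by rewrite big_ord0 mul0r T0 subrr.
have nh0 : 0 <= n%:R * h by rewrite mulr_ge0.
rewrite big_ord_recr/= IH TB// -TD// addrA subrK.
by rewrite -natr1 mulrDl mul1r.
Qed.

(** As A (S g) = - g, this is the integral of T s g over [0, t]. *)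
Definition primitive t g := S g - T t (S g).

Lemma primitive_cvg g : h^-1 *: primitive h g @[h --> (0 : R)^'+] --> g.
Proof.
case: rS => /(_ g); rewrite scale0r sub0r => Sg _ _.
rewrite -[X in _ --> X]opprK.
have : - (h^-1 *: (T h (S g) - S g)) @[h --> (0 : R)^'+] --> - - g
  by exact: cvgN.
apply: cvg_trans; apply: near_eq_cvg; near=> h.
by rewrite /= -scalerN opprB.
Unshelve. all: by end_near. Qed.

(** With a step h dividing t, the increment S g - T t (S g) is the sum of the
   T (k h) applied to the increment over [0, h], and the latter is close to
   h g, whose images are positive. *)
Lemma primitive_ge0 t g : 0 <= t -> 0 ⊑ g -> 0 ⊑ primitive t g.
Proof.
rewrite le_eqVlt => /predU1P[<- _|t0 g0].
  by rewrite /primitive T0 subrr; exact: blat_le_refl.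
have [K K0 TK] := bounded_on_interval (ltW t0).
apply: blat_ge0_approx => e e0.
have eK : 0 < e / (t * K) by rewrite divr_gt0// mulr_gt0.
have /cvgrPdist_le/(_ _ eK) near_g := @primitive_cvg g.
have [m m0] := near_divisor t0 near_g; set h := t / m%:R => gh.
have m0' : 0 < m%:R :> R by rewrite ltr0n.
have h0 : 0 < h by rewrite divr_gt0.
have mh : m%:R * h = t by rewrite mulrC divfK// gt_eqF.
set r := g - h^-1 *: primitive h g in gh.
have kh0 (k : 'I_m) : 0 <= k%:R * h by rewrite mulr_ge0// ltW.
exists (h *: \sum_(k < m) T (k%:R * h) r).
  rewrite normrZ gtr0_norm//.
  apply: le_trans (_ : h * \sum_(k < m) (K * (e / (t * K))) <= _).
    rewrite ler_wpM2l ?(ltW h0)//; apply: le_trans (ler_norm_sum _ _ _) _.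
    apply: ler_sum => k _; apply: le_trans (TK _ _ _) _.
      rewrite kh0/= -mh ler_wpM2r ?(ltW h0)// ler_nat; exact: ltnW.
    by rewrite ler_wpM2l// ltW.
  rewrite sumr_const card_ord -[_ *+ m]mulr_natl mulrA (mulrC h) mh.
  by rewrite mulrA mulrCA divff ?mulr1// gt_eqF// mulr_gt0.
rewrite /primitive -mh -telescope_sum ?(ltW h0)//.
rewrite (_ : _ + _ = h *: \sum_(k < m) T (k%:R * h) g).
  apply: blat_scale_ge0; first exact: ltW.
  by apply: blat_sum_ge0 => k; exact: Tpos.
rewrite -[X in X + _ = _](scalerKV (lt0r_neq0 h0)) -scalerDr.
congr (_ *: _); rewrite scaler_sumr -big_split/=.
apply: eq_bigr => k _.
by rewrite (@TB _ g (h^-1 *: primitive h g) (kh0 k)) TZ// addrC subrK.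
Qed.

(** T t commutes with difference quotients, hence A (T t (S g)) = - T t g. *)
Lemma resolvent_commute t g : 0 <= t -> S (T t g) = T t (S g).
Proof.
move=> t0; case: rS => ST SK _.
have : has_generator T (T t (S g)) (T t (- g)).
  have := ST g; rewrite scale0r sub0r => Sg.
  have [_ ct] : linear (T t) /\ continuous (T t) by case: ssgT => Tl _ _ _;
    exact: Tl.
  have : T t (h^-1 *: (T h (S g) - S g)) @[h --> (0 : R)^'+] --> T t (- g).
    by apply: continuous_cvg => //; exact: ct.
  apply: cvg_trans; apply: near_eq_cvg; near=> h; have h0 : 0 < h by [].
  by rewrite TZ// TB// TC// ltW.
move=> /SK; rewrite scale0r sub0r -[- g]sub0r TB// -[X in T t X](subrr g).
by rewrite TB// subrr sub0r opprK.
Unshelve. all: by end_near. Qed.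

Lemma resolvent_dominates t g : 0 <= t -> 0 ⊑ g -> T t (S g) ⊑ S g.
Proof. by move=> t0 g0; apply/blat_subr_ge0; exact: primitive_ge0. Qed.

Lemma primitive_mono t x y : 0 <= t -> x ⊑ y ->
  primitive t x ⊑ primitive t y.
Proof.
move=> t0 /blat_subr_ge0 xy; apply/blat_subr_ge0.
have Slin := real_resolvent_linear ssgT rS.
pose S' : {linear E -> E} := HB.pack S (GRing.isLinear.Build _ _ _ _ _ Slin).
suff -> : primitive t y - primitive t x = primitive t (y - x).
  exact: primitive_ge0.
have SB u v : S (u - v) = S u - S v by exact: (linearB S').
by rewrite /primitive SB TB// !opprB addrACA [RHS]addrACA; congr (_ + _);
  exact: addrC.
Qed.

Lemma primitive_commute s t g : 0 <= s -> 0 <= t ->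
  T s (primitive t g) = primitive t (T s g).
Proof. by move=> s0 t0; rewrite /primitive TB// TC// resolvent_commute. Qed.

(** The key estimate.  Write I for the integral of T over [0, 1/N].  Then
   N I (T t f) is the sum over i < N of
   T (t - 1) T (i/N) I (T (1 - i/N) f), and T (1 - i/N) f <= g bounds the sum
   by the integral of T s g over [t - 1, t], hence by S g. *)
Lemma orbit_dominated N t f g : (0 < N)%N -> 1 <= t -> 0 ⊑ g ->
  (forall i, (i < N)%N -> T (i.+1%:R / N%:R) f ⊑ g) ->
  N%:R *: primitive N%:R^-1 (T t f) ⊑ S g.
Proof.
move=> N0 t1 g0 fg; set h := (N%:R : R)^-1.
have N0' : 0 < N%:R :> R by rewrite ltr0n.
have h0 : 0 <= h by rewrite invr_ge0 ltW.
have Nh : N%:R * h = 1 by rewrite divff// gt_eqF.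
have t10 : 0 <= t - 1 by rewrite subr_ge0.
have -> : T t f = T (t - 1) (T 1 f) by rewrite -TD// subrK.
rewrite -primitive_commute// -TZ//.
apply: blat_le_trans_at (resolvent_dominates t10 g0); apply: Tmono => //.
apply: (@blat_le_trans_at _ _ (primitive 1 g)); last first.
  apply/blat_subr_ge0; rewrite /primitive opprB addrCA subrr addr0.
  by apply: Tpos => //; exact: S_pos.
have -> : primitive 1 g = \sum_(i < N) T (i%:R * h) (primitive h g).
  by rewrite /primitive telescope_sum// Nh.
have -> : N%:R *: primitive h (T 1 f) = \sum_(i < N) primitive h (T 1 f).
  by rewrite sumr_const card_ord scaler_nat.
apply/blat_subr_ge0; rewrite -sumrB; apply: blat_sum_ge0 => i.
have ih0 : 0 <= i%:R * h by rewrite mulr_ge0.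
rewrite primitive_commute//; apply/blat_subr_ge0; apply: primitive_mono => //.
have -> : T 1 f = T (i%:R * h) (T ((N - i.+1).+1%:R / N%:R) f).
  rewrite -TD// -/h.
  by rewrite -mulrDl -natrD subnSK// subnKC ?Nh// ltnW.
by apply: Tmono => //; apply: fg; rewrite subnSK// leq_subr.
Qed.

(** For t >= 1 take for g the supremum of the vectors T (i/N) f, 0 < i <= N:
   in an AM-space its norm is the largest of theirs, whatever N is.
   [orbit_dominated] bounds N I (T t f), which tends to T t f as N grows. *)
Lemma bounded_on_cone : AM_space E -> exists2 K : R, 0 <= K &
  forall t f, 0 <= t -> 0 ⊑ f -> `|T t f| <= K * `|f|.
Proof.
move=> AM; have [C C0 SC'] := SC; have [M M0 TM] := bounded_on_interval ler01.
have CM0 : 0 <= C * M by rewrite mulr_ge0// ltW.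
exists (C * M + M); first by rewrite addr_ge0// ltW.
move=> t f t0 f0; have [t1|/ltW t1] := leP t 1.
  apply: le_trans (TM t f _) _; first by rewrite t0.
  by rewrite ler_wpM2r// lerDr.
apply: le_trans (_ : C * M * `|f| <= _); last first.
  by rewrite ler_wpM2r// lerDl ltW.
apply/ler_addgt0Pl => e e0.
have /cvgrPdist_le/(_ _ e0) near_y := @primitive_cvg (T t f).
have [N N0] := near_divisor ltr01 near_y.
rewrite mul1r invrK => ye.
rewrite -[T t f](subrK (N%:R *: primitive N%:R^-1 (T t f))).
apply: le_trans (ler_normD _ _) _; rewrite lerD//.
pose g := blat_sups (fun i => T (i.+1%:R / N%:R) f) N.
have g0 : 0 ⊑ g := blat_sups_ge0 _ _.
have N0' : 0 < N%:R :> R by rewrite ltr0n.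
have gf : `|g| <= M * `|f|.
  apply: norm_blat_sups => //; first by rewrite mulr_ge0// ltW.
  move=> i iN; have i0 : 0 <= i.+1%:R / N%:R :> R by rewrite divr_ge0.
  split; first exact: Tpos.
  by apply: TM; rewrite i0/= ler_pdivrMr// mul1r ler_nat.
have dom := @orbit_dominated N t f g N0 t1 g0 (fun i iN => blat_le_sups _ iN).
apply: le_trans (blat_norm_mono _ dom) _.
  apply: blat_scale_ge0; first exact: ltW.
  by apply: primitive_ge0; [rewrite invr_ge0 ltW|exact: Tpos].
by apply: le_trans (SC' g) _; rewrite -mulrA ler_wpM2l// ltW.
Qed.

Lemma bounded_of_positive_resolvent : AM_space E -> exists K : R,
  forall t f, 0 <= t -> `|T t f| <= K * `|f|.
Proof.
move=> /bounded_on_cone[K K0 TK]; exists (2 * K) => t f t0.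
rewrite {1}(blat_posB f) TB//; apply: le_trans (ler_normB _ _) _.
apply: le_trans (lerD (TK _ _ t0 (blat_pos_ge0 _))
  (TK _ _ t0 (blat_pos_ge0 _))) _.
rewrite -mulrA mulr_natl mulr2n lerD// ler_wpM2l// ?norm_blat_pos//.
by rewrite -(normrN f) norm_blat_pos.
Qed.

End Stability.

(** * The two inequalities *)

Section Spectral_bounds.
Context (R : realType) (E : completeNormedModType R) (T : R -> E -> E).
Hypothesis ssgT : C0_semigroup T.

Lemma spectral_bound_le_growth_bound :
  (spectral_bound (complexify_op (generator idfun T)) <=
   growth_bound idfun T)%E.
Proof.
apply: ge_ereal_sup => _ [l lA <-]; apply: le_ereal_inf_tmp => _ [w [M wM] <-].
rewrite lee_fin leNgt; apply/negP => wl; apply: lA.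
exact: (resolvent_right_half_plane ssgT wM).
Qed.

(** At a real l the operator l - A acts on the two parts separately, so the
   first part of the resolvent at (f, 0) solves the real equation. *)
Lemma real_resolvent_of_complexification (l : R) :
  resolvent_set (complexify_op (generator idfun T)) l%:C ->
  exists S, real_resolvent T l S.
Proof.
move=> [S [Sc SA AS]].
pose A := generator idfun T; pose S1 f := (S (f, 0)).1.
have gen0 : has_generator T 0 0.
  have : (fun=> 0) h @[h --> (0 : R)^'+] --> (0 : E) by exact: cvg_cst.
  apply: cvg_trans; apply: near_eq_cvg; near=> h; have h0 : 0 < h by [].
  have [Tl _ _ _] := ssgT; have [lh _] := Tl h (ltW h0).
  by have := lh (- 1) 0 0; rewrite scaler0 addr0 scaleN1r addNr => ->;
    rewrite subrr scaler0.
have [d0 e0] := (has_generatorP T 0 0).1 gen0.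
have ST f : has_generator T (S1 f) (l *: S1 f - f).
  have [[d1 _] e1] := SA (f, 0); apply/has_generatorP; split => //.
  have e1f : l *: S1 f - 0 *: (S (f, 0)).2 - generator idfun T (S1 f) = f.
    exact: (congr1 fst e1).
  by move: e1f; rewrite scale0r subr0 => e1f; rewrite -[X in _ - X]e1f subKr.
have SK x y : has_generator T x y -> S1 (l *: x - y) = x.
  move=> /has_generatorP[xd xy].
  have argE : l%:C *: ((x, 0) : complexification E) -
      complexify_op (generator idfun T) (x, 0) = (l *: x - y, 0).
    transitivity ((l *: x - 0 *: 0 - generator idfun T x,
                   l *: 0 + 0 *: x - generator idfun T 0) : E * E); first by [].
    by rewrite xy e0 scale0r !scaler0 scale0r !subr0 addr0.
  have := AS (x, 0) (conj xd d0).
  by rewrite argE => ASx; rewrite /S1 ASx.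
have S1lin := generator_inverse_linear ssgT ST SK.
have S1cont : continuous S1.
  move=> f; have Sf : S z @[z --> ((f, 0) : E * E)] --> (S (f, 0) : E * E)
    by exact: Sc.
  have fc : (g, 0 : E) @[g --> f] --> ((f, 0) : E * E).
    by apply/cvg_prodP; split => /=; [exact: cvg_id|exact: cvg_cst].
  have : S (g, 0) @[g --> f] --> (S (f, 0) : E * E) by exact: cvg_comp fc Sf.
  by move=> /cvg_prodP[].
exists S1; split => //; exact: continuous_linear_bound.
Unshelve. all: by end_near. Qed.

End Spectral_bounds.

Section Real_case.
Context (R : realType) (E : banachLatticeType R) (T : R -> E -> E).
Hypothesis ssgT : C0_semigroup T.

Hypothesis Tpos : positive_semigroup [set f : E | blat_le 0 f] T.

(** Every real w above the spectral bound makes e^(- w t) T t bounded: the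
   resolvent at w is positive by [resolvent_pos], and after rescaling it is
   the operator S of [bounded_of_positive_resolvent]. *)
Lemma growth_bound_le_spectral_bound : AM_space E ->
  (growth_bound idfun T <=
   spectral_bound (complexify_op (generator idfun T)))%E.
Proof.
move=> AM; set s := spectral_bound _.
have above (w : R) : (s < w%:E)%E -> (growth_bound idfun T <= w%:E)%E.
  move=> sw; apply: ereal_inf_lbound; exists w => //=.
  have rS l : w <= l -> exists S, real_resolvent T l S.
    move=> wl; apply: (real_resolvent_of_complexification ssgT);
      apply: contrapT => nl.
    have : (l%:E <= s)%E by apply: ereal_sup_ubound; exists l%:C.
    by apply/negP; rewrite -ltNge; apply: lt_le_trans sw _; rewrite lee_fin.
  have [S rSw] := rS w (lexx w).
  have S0 := resolvent_pos ssgT Tpos rS rSw.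
  have rS0 := rescale_resolvent (- w) ssgT rSw; rewrite subrr in rS0.
  have posr : positive_semigroup [set f : E | blat_le 0 f] (rescale T (- w)).
    by move=> t f t0 f0; apply: blat_scale_ge0; [exact: expR_ge0|exact: Tpos].
  have [K TK] := 
    bounded_of_positive_resolvent (rescale_C0 (- w) ssgT) posr rS0 S0 AM.
  by exists K => t x; exact: TK.
case: s above => [r|_|above]; last 2 first.
- exact: leey.
- case: (growth_bound idfun T) above => [r|/(_ 0 (ltNyr _))|//] above.
    by have := above (r - 1 : R) (ltNyr _); rewrite lee_fin lerBrDr gerDl ler10.
  by rewrite leye_eq.
move=> above; apply/lee_addgt0Pr => e e0; apply: above.
by rewrite lte_fin ltrDl.
Qed.

End Real_case.

(** * Complex Banach lattices *)

Section Conjugation.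
Context (R : realType) (V W : preTopologicalLmodType R[i]).
Context (A : unbounded_op V) (B : unbounded_op W) (f : V -> W) (g : W -> V).
Hypothesis gK : cancel g f.
Hypotheses (f_lin : linear f) (g_lin : linear g).
Hypotheses (f_cont : continuous f) (g_cont : continuous g).
Hypothesis fAB : forall z, op_dom A z -> op_dom B (f z) /\ B (f z) = f (A z).
Hypothesis gBA : forall z, op_dom B z -> op_dom A (g z) /\ A (g z) = g (B z).

Lemma resolvent_set_conj l : resolvent_set A l -> resolvent_set B l.
Proof.
have fB c x y : f (c *: x - y) = c *: f x - f y.
  pose f' : {linear V -> W} := HB.pack f (GRing.isLinear.Build _ _ _ _ _ f_lin).
  by rewrite -[f]/(f' : V -> W) linearB linearZ.
have gB c x y : g (c *: x - y) = c *: g x - g y.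
  pose g' : {linear W -> V} := HB.pack g (GRing.isLinear.Build _ _ _ _ _ g_lin).
  by rewrite -[g]/(g' : W -> V) linearB linearZ.
move=> [S [Sc SA AS]]; exists (f \o S \o g); split.
- move=> x; apply: continuous_comp; first exact: g_cont.
  by apply: continuous_comp; [exact: Sc|exact: f_cont].
- move=> w /=; have [d e] := SA (g w); have [d' e'] := fAB d.
  by split => //; rewrite e' -fB e gK.
- move=> w dw /=; have [d e] := gBA dw.
  by rewrite gB -e AS// gK.
Qed.

End Conjugation.

Section Complex_case.
Context (R : realType) (V : complexBanachLattice R).
Local Notation E := (cblat_re V).
Local Notation inj := (@cblat_inj R V).
Implicit Types (x y : E) (z : E * E).

Lemma cblat_inj0 : inj 0 = 0.
Proof. by apply: (addIr (inj 0)); rewrite -cblat_injD !add0r. Qed.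

Lemma cblat_injN x : inj (- x) = - inj x.
Proof. by apply: (addIr (inj x)); rewrite -cblat_injD !addNr cblat_inj0. Qed.

Definition of_parts z : V := inj z.1 + 'i%C *: inj z.2.

Lemma of_parts_inj : injective of_parts.
Proof. by move=> [x y] [x' y'] /cblat_decomp_inj[/= -> ->]. Qed.

Lemma of_parts_surj (v : V) : exists z, of_parts z = v.
Proof. by have [x [y ->]] := cblat_decomp v; exists (x, y). Qed.

Definition parts (v : V) : E * E := sval (cid (of_parts_surj v)).

Lemma partsK : cancel parts of_parts.
Proof. by move=> v; rewrite /parts; case: cid. Qed.

Lemma of_partsK : cancel of_parts parts.
Proof. by move=> z; apply: of_parts_inj; rewrite partsK. Qed.

Lemma of_parts_real x : of_parts (x, 0) = inj x.
Proof. by rewrite /of_parts /= cblat_inj0 scaler0 addr0. Qed.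

Lemma of_parts_linear : linear (of_parts : complexification E -> V).
Proof.
move=> [a b] [x y] [x' y'].
transitivity (inj (a *: x - b *: y + x') + 'i%C *: inj (a *: y + b *: x + y')).
  by [].
rewrite /of_parts /= !cblat_injD cblat_injN !cblat_injZ (complexE (a +i* b)) /=.
set X := inj x; set Y := inj y; set X' := inj x'; set Y' := inj y'.
rewrite !scalerDr !scalerDl !scalerA mulrAC -expr2 sqr_i mulN1r scaleNr.
rewrite addrACA (mulrC a%:C); congr (_ + _).
by rewrite [_ *: Y + _ *: X]addrC addrACA; congr (_ + _); exact: addrC.
Qed.

Lemma cblat_norm_inj x : `|inj x| = (`|x|)%:C.
Proof.
have [m mod_m] := cblat_norm x 0.
rewrite cblat_inj0 scaler0 addr0 => ->; congr (_%:C).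
have [_ m_least] := mod_m; have [xm _] := abs_le_modulus mod_m.
suff -> : m = blat_abs x by rewrite norm_blat_abs.
apply: blat_le_anti => //; apply: m_least => theta; rewrite scaler0 addr0.
by apply: blat_scale_le_abs; rewrite cos_geN1 cos_le1.
Qed.

Lemma cblat_norm_ge z : (`|z|)%:C <= `|of_parts z|.
Proof.
case: z => x y; have [m mod_m] := cblat_norm x y.
rewrite /of_parts /= => ->; rewrite lecR.
have [xm ym] := abs_le_modulus mod_m.
rewrite prod_normE ge_max.
rewrite -[`|(x, y).1|]norm_blat_abs -[`|(x, y).2|]norm_blat_abs.
by rewrite !blat_norm_mono//; exact: blat_abs_ge0.
Qed.

Lemma cblat_norm_le z : `|of_parts z| <= (2 * `|z|)%:C.
Proof.
apply: le_trans (ler_normD _ _) _; rewrite normrZ !cblat_norm_inj.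
have -> : `|'i%C : R[i]| = 1 by rewrite normc_def /= expr0n expr1n add0r sqrtr1.
rewrite mul1r -raddfD lecR mulr_natl mulr2n lerD// prod_normE le_max lexx//.
by rewrite orbT.
Qed.

Lemma of_partsB z z' : of_parts (z - z') = of_parts z - of_parts z'.
Proof.
rewrite /of_parts /= !cblat_injD !cblat_injN scalerDr scalerN opprD.
by rewrite addrACA.
Qed.

(** The norm of E * E and that of V are equivalent, by [cblat_norm_ge] and
   [cblat_norm_le]. *)
Lemma of_parts_cvg (U : Type) (F : set_system U) {FF : Filter F}
    (u : U -> E * E) z :
  u k @[k --> F] --> z <-> of_parts (u k) @[k --> F] --> of_parts z.
Proof.
split=> [/cvgrPdist_le uz|/cvgrPdist_le uz]; apply/cvgrPdist_le => e e0.
  have eE : e = (complex.Re e)%:C.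
    by apply/eqP; rewrite eq_complex /= eqxx (ger0_Im (ltW e0)) eqxx.
  have er0 : 0 < complex.Re e / 2 by rewrite divr_gt0// -ltcR -eE.
  apply: filterS (uz _ er0) => k uk.
  rewrite -of_partsB; apply: le_trans (cblat_norm_le _) _.
  by rewrite eE lecR mulrC -ler_pdivlMr.
have e0' : 0 < e%:C by rewrite ltcR.
apply: filterS (uz _ e0') => k;
  rewrite -of_partsB => /(le_trans (cblat_norm_ge _)).
by rewrite lecR.
Qed.

Lemma inj_cvg (U : Type) (F : set_system U) {FF : Filter F} (u : U -> E) x :
  u k @[k --> F] --> x <-> inj (u k) @[k --> F] --> inj x.
Proof.
rewrite -of_parts_real.
have -> : (fun k => inj (u k)) = (fun k => of_parts (u k, 0)).
  by apply/funext => k; rewrite of_parts_real.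
split=> [ux|/of_parts_cvg/cvg_prodP[]//].
by apply/of_parts_cvg/cvg_prodP; split => //=; exact: cvg_cst.
Qed.

Lemma cblat_inj_inj : injective inj.
Proof. by move=> x y; rewrite -!of_parts_real => /of_parts_inj[]. Qed.

Lemma of_parts_continuous : continuous (of_parts : complexification E -> V).
Proof. by move=> z; apply/(@of_parts_cvg _ _ _ id z); exact: cvg_id. Qed.

Lemma parts_continuous : continuous (parts : V -> complexification E).
Proof.
move=> v; apply/(@of_parts_cvg _ _ _ parts (parts v)); rewrite partsK.
by under eq_fun do rewrite partsK; exact: cvg_id.
Qed.

Lemma parts_linear : linear (parts : V -> complexification E).
Proof.
move=> c v w; apply: of_parts_inj.
by rewrite partsK of_parts_linear !partsK.
Qed.

Context (T : R -> V -> V).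
Hypothesis ssgT : C0_semigroup T.
Hypothesis Tpos :
  positive_semigroup [set inj f | f in [set f : E | 0 ⊑ f]] T.

(** The restriction of T to the real part of V, where it takes its values by
   [semigroup_inj]. *)
Definition real_part_semigroup (t : R) x : E := (parts (T t (inj x))).1.
Local Notation Tre := real_part_semigroup.

Let Tl t : 0 <= t -> linear (T t).
Proof. by case: ssgT => Tl _ _ _ /Tl[]. Qed.

Let TD t v w : 0 <= t -> T t (v + w) = T t v + T t w.
Proof.
by move=> t0; have := Tl t0 1 v w; rewrite !scale1r.
Qed.

Let TZ t c v : 0 <= t -> T t (c *: v) = c *: T t v.
Proof.
move=> t0; pose g : {linear V -> V} :=
  HB.pack (T t) (GRing.isLinear.Build _ _ _ _ _ (Tl t0)).
by rewrite -[T t]/(g : V -> V) linearZ.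
Qed.

(** A real vector is a difference of two positive ones, and T t maps these to
   positive, hence real, vectors. *)
Lemma semigroup_inj t x : 0 <= t -> T t (inj x) = inj (Tre t x).
Proof.
move=> t0.
have [f1 _ Tf1] := Tpos t0 (ex_intro2 _ _ (blat_pos x) (blat_pos_ge0 x) erefl).
have [f2 _ Tf2] := Tpos t0
  (ex_intro2 _ _ (blat_pos (- x)) (blat_pos_ge0 (- x)) erefl).
have Tx : T t (inj x) = inj (f1 - f2).
  rewrite {1}(blat_posB x) !cblat_injD !cblat_injN Tf1 Tf2.
  by rewrite TD// -scaleN1r TZ// scaleN1r.
by rewrite /Tre Tx -[inj (f1 - f2)]of_parts_real of_partsK /= of_parts_real.
Qed.

Lemma semigroup_of_parts t z : 0 <= t ->
  T t (of_parts z) = of_parts (Tre t z.1, Tre t z.2).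
Proof.
by move=> t0; rewrite /of_parts TD// TZ// !semigroup_inj.
Qed.

Lemma real_part_semigroup_C0 : C0_semigroup Tre.
Proof.
have [Tlin T0 TDt Tcvg] := ssgT; split.
- move=> t t0; split.
    move=> c x y; apply: cblat_inj_inj.
    rewrite -semigroup_inj// !cblat_injD !cblat_injZ -!semigroup_inj//.
    by rewrite TD// TZ.
  move=> x; apply/inj_cvg; rewrite -semigroup_inj//.
  under eq_fun do rewrite -semigroup_inj//.
  have [_ ct] := Tlin t t0.
  have inj_x : inj y @[y --> x] --> inj x.
    by apply/(@inj_cvg _ _ _ id x); exact: cvg_id.
  exact: cvg_comp inj_x (ct (inj x)).
- by move=> x; apply: cblat_inj_inj; rewrite -semigroup_inj// T0.
- move=> s t x s0 t0; apply: cblat_inj_inj.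
  by rewrite -!semigroup_inj ?addr_ge0// TDt.
- move=> x; apply/inj_cvg; apply: cvg_trans (Tcvg (inj x)).
  apply: near_eq_cvg; near=> t; have t0 : 0 < t by [].
  by rewrite semigroup_inj// ltW.
Unshelve. all: by end_near. Qed.

Lemma real_part_semigroup_pos : positive_semigroup [set f : E | 0 ⊑ f] Tre.
Proof.
move=> t f t0 f0; have [g g0 Tg] := Tpos t0 (ex_intro2 _ _ f f0 erefl).
by have := semigroup_inj f t0; rewrite -Tg => /cblat_inj_inj <-.
Qed.

(** Difference quotients are computed part by part. *)
Lemma generator_of_parts z u :
  (real_complex R h^-1 *: (T h (of_parts z) - of_parts z)) @[h --> (0 : R)^'+]
    --> of_parts u <->
  has_generator Tre z.1 u.1 /\ has_generator Tre z.2 u.2.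
Proof.
have E1 : {near (0 : R)^'+, (fun h =>
  of_parts (h^-1 *: (Tre h z.1 - z.1), h^-1 *: (Tre h z.2 - z.2))) =1
   (fun h => real_complex R h^-1 *: (T h (of_parts z) - of_parts z))}.
  near=> h; have h0 : 0 < h by [].
  rewrite semigroup_of_parts ?(ltW h0)// -of_partsB /of_parts /= !cblat_injZ.
  by rewrite scalerDr; congr (_ + _); rewrite !scalerA mulrC.
split.
  move=> H; have : of_parts (h^-1 *: (Tre h z.1 - z.1),
    h^-1 *: (Tre h z.2 - z.2)) @[h --> (0 : R)^'+] --> of_parts u.
    by apply: cvg_trans H; apply: near_eq_cvg; apply: filterS E1 => h ->.
  by move=> /of_parts_cvg/cvg_prodP[].
move=> H; apply: cvg_trans (near_eq_cvg E1) _.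
by apply/of_parts_cvg/cvg_prodP.
Unshelve. all: by end_near. Qed.

Local Notation A := (complexify_op (generator idfun Tre)).
Local Notation B := (generator (real_complex R) T).

Lemma op_dom_of_parts (z : complexification E) : op_dom A z ->
  op_dom B (of_parts z) /\ B (of_parts z) = of_parts (A z).
Proof.
move=> [d1 d2]; have H := (generator_of_parts z (A z)).2 (conj d1 d2).
by split; [exact: cvgP H|exact: cvg_lim H].
Qed.

Lemma op_dom_parts (v : V) : op_dom B v ->
  op_dom A (parts v) /\ A (parts v) = parts (B v).
Proof.
move=> dv.
have /generator_of_parts[/has_generatorP[d1 e1] /has_generatorP[d2 e2]] :
    (real_complex R h^-1 *: (T h (of_parts (parts v)) - of_parts (parts v)))
      @[h --> (0 : R)^'+] --> of_parts (parts (B v)).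
  by rewrite !partsK; exact: dv.
split; first by split.
transitivity ((generator idfun Tre (parts v).1,
  generator idfun Tre (parts v).2) : E * E).
  by [].
by rewrite e1 e2; case: (parts _).
Qed.

Lemma spectrum_of_parts : spectrum B = spectrum A.
Proof.
rewrite /spectrum; congr (~` _); apply/seteqP; split => l.
  exact: (@resolvent_set_conj R V (complexification E) B A parts of_parts
    of_partsK parts_linear of_parts_linear
    parts_continuous of_parts_continuous op_dom_parts op_dom_of_parts).
exact: (@resolvent_set_conj R (complexification E) V A B of_parts parts
  partsK of_parts_linear parts_linear
  of_parts_continuous parts_continuous op_dom_of_parts op_dom_parts).
Qed.

Lemma growth_bound_of_parts :
  growth_bound (real_complex R) T = growth_bound idfun Tre.
Proof.
congr (ereal_inf [set w%:E | w in _]); apply/seteqP; split => w [M wM].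
  exists M => t x t0; have := wM t (inj x) t0.
  by rewrite semigroup_inj// -cblat_injZ !cblat_norm_inj -rmorphM lecR.
exists (2 * `|M|) => t v t0; rewrite -(partsK v); set z := parts v.
have -> : real_complex R (expR (- w * t)) *: T t (of_parts z) =
    of_parts (expR (- w * t) *: Tre t z.1, expR (- w * t) *: Tre t z.2).
  rewrite semigroup_of_parts// /of_parts /= !cblat_injZ.
  by rewrite scalerDr; congr (_ + _); rewrite !scalerA mulrC.
apply: le_trans (cblat_norm_le _) _.
apply: le_trans (_ : (2 * `|M|)%:C * (`|z|)%:C <= _); last first.
  by rewrite ler_wpM2l ?cblat_norm_ge// lecR mulr_ge0.
rewrite -rmorphM lecR -mulrA ler_wpM2l// prod_normE ge_max.
apply/andP; split; apply: le_trans (wM t _ t0) _;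
  apply: le_trans (ler_wpM2r _ (ler_norm M)) _ => //.
  by rewrite ler_wpM2l// prod_normE le_max lexx.
by rewrite ler_wpM2l// prod_normE le_max lexx orbT.
Qed.

End Complex_case.

Theorem theorem1 (R : realType) :
  (forall (E : banachLatticeType R) (T : R -> E -> E),
     AM_space E ->
     C0_semigroup T ->
     positive_semigroup [set f : E | blat_le 0 f] T ->
     spectral_bound (complexify_op (generator idfun T))
       = growth_bound idfun T) /\
  (forall (E : complexBanachLattice R) (T : R -> E -> E),
     AM_space (cblat_re E) ->
     C0_semigroup T ->
     positive_semigroup [set cblat_inj f | f in [set f : cblat_re E | blat_le 0 f]] T ->
     spectral_bound (generator (real_complex R) T)
       = growth_bound (real_complex R) T).
Proof.
have real_case (E : banachLatticeType R) (T : R -> E -> E) : AM_space E ->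
    C0_semigroup T -> positive_semigroup [set f : E | 0 ⊑ f] T ->
    spectral_bound (complexify_op (generator idfun T)) = growth_bound idfun T.
  move=> AM ssgT Tpos; apply/le_anti/andP; split.
    exact: spectral_bound_le_growth_bound.
  exact: growth_bound_le_spectral_bound.
split=> // E T AM ssgT Tpos.
rewrite (growth_bound_of_parts ssgT Tpos).
rewrite /spectral_bound (spectrum_of_parts ssgT Tpos).
apply: real_case => //; first exact: real_part_semigroup_C0.
exact: real_part_semigroup_pos.
Qed.
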